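(* Let $M$ be a matroid on the ground set $E=\{0,\ldots,n\}$, let $a_1,\ldots,a_n$ be nonnegative integers with $\sum_{i=1}^na_i=\mathrm{rk}(M)-2$, and let $j\in \{1,\ldots,n\}$. Then $$A_M(a_1,\ldots,a_{j-1},a_j+1,a_{j+1},\ldots,a_n)= \sum_{F\in Z(a_1,\ldots,a_n)}B_{j,\,n+1-|F|}\;A_{M/F}(a_1,\ldots,a_{n-|F|})\;A_{M|F}(a_{n+2-|F|},\ldots,a_n),$$ where $B_{i,j}=\frac{\min(i,j)\,(n+1-\max(i,j))}{n+1}$ and the sum ranges over all elements of the set $$Z(a_1,\ldots,a_n)=\left\{F \in \mathrm{Flat}(M)\setminus \{\emptyset,E\}\ \middle|\ a_{n+1-|F|}=0,\ \sum_{i=1}^{n-|F|}a_i=\mathrm{crk}_M(F)-1\right\}.$$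
   Context: $\mathrm{Flat}(M)$ is the set of flats of $M$; $\mathrm{crk}_M(F)=\mathrm{rk}(M)-\mathrm{rk}_M(F)$; $M|F$ (on ground set $F$) is the restriction and $M/F$ (on ground set $E\setminus F$) the contraction. Matroidal mixed Eulerian numbers, for a matroid $N$ on a finite nonempty set $G$ with $|G|=m+1$: let $\mathrm{CH}(X_{\Pi_G},\mathbb{Q})=\mathbb{Q}[x_S:\emptyset\subsetneq S\subsetneq G]/(I_l+I_q)$ be the Chow ring of the $m$-dimensional permutohedral variety, where $I_q$ is generated by $x_Sx_T$ for inclusion-incomparable $S,T$ and $I_l$ by $\sum_{S\ni a}x_S-\sum_{S\ni b}x_S$ for $a,b\in G$. The degree map $\int_{X_{\Pi_G}}:\mathrm{CH}^m\to\mathbb{Q}$ is the isomorphism sending $x_{F_1}\cdots x_{F_m}$ to $1$ for every complete chain $\emptyset\subsetneq F_1\subsetneq\dots\subsetneq F_m\subsetneq G$ (for $m=0$ it is the identity of $\mathbb{Q}$). For $1\le i\le m$ and a fixed $g\in G$ (the class does not depend on $g$), $L_i=\sum_{S}c_{i,S}\,x_S$ with $c_{i,S}=\min(m+1-i,|S|)$ if $g\notin S$ and $c_{i,S}=\min(m+1-i,|S|)-(m+1-i)$ if $g\in S$. For loopless $N$ of rank $\rho\geq 1$, $[X_N]\in\mathrm{CH}^{m-\rho+1}(X_{\Pi_G},\mathbb{Q})$ is the unique class such that, for every chain $\emptyset\subsetneq F_1\subsetneq\dots\subsetneq F_{\rho-1}\subsetneq G$, $\int[X_N]x_{F_1}\cdots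 x_{F_{\rho-1}}$ equals $1$ if all $F_i$ are flats of $N$ and $0$ otherwise; if $N$ has a loop, $[X_N]=0$. For nonnegative integers $a_1,\dots,a_m$ summing to $\rho-1$, $A_N(a_1,\dots,a_m)=\int_{X_{\Pi_G}}[X_N]L_1^{a_1}\cdots L_m^{a_m}$. (For $m=0$ the argument list is empty.) *)

(* Defs.v *)
From HB Require Import structures.
From mathcomp Require Import all_boot all_order all_algebra.
From mathcomp Require Import boolp.
From mathcomp Require classical_sets.
From mathcomp Require Import mpoly.

Set Implicit Arguments.
Unset Strict Implicit.
Unset Printing Implicit Defensive.

Import Order.TTheory GRing.Theory Num.Theory.

Local Open Scope ring_scope.
Local Open Scope quotient_scope.

(* Ground sets are subsets [E] of an ambient finite type [T]. Only the values
   of [rk] on subsets of [E] matter. *)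
Record matroid (T : finType) (E : {set T}) := Matroid {
  rk : {set T} -> nat;
  rk_card : forall A : {set T}, A \subset E -> (rk A <= #|A|)%N;
  rk_mono : forall A B : {set T}, A \subset B -> B \subset E -> (rk A <= rk B)%N;
  rk_submod : forall A B : {set T}, A \subset E -> B \subset E ->
    (rk (A :|: B) + rk (A :&: B) <= rk A + rk B)%N
}.

Section Matroids.
Variables (T : finType) (E : {set T}) (M : matroid E).

Definition mrank : nat := rk M E.

Definition flat (F : {set T}) : bool :=
  (F \subset E) && [forall e in E :\: F, rk M F < rk M (e |: F)]%N.

Definition crk (F : {set T}) : nat := (mrank - rk M F)%N.

Definition loopless : bool := [forall e in E, rk M [set e] != 0%N].

(* Intersecting with [E] makes the two minors below total in [F]; it changes
   nothing when [F \subset E]. *)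
Definition restr_rk (F A : {set T}) : nat := rk M (A :&: E).

Definition contr_rk (F A : {set T}) : nat :=
  (rk M ((A :|: F) :&: E) - rk M (F :&: E))%N.

Lemma restr_rk_card (F A : {set T}) : A \subset F -> (restr_rk F A <= #|A|)%N.
Proof.
move=> _; apply: leq_trans (rk_card M (subsetIr _ _)) _.
exact/subset_leq_card/subsetIl.
Qed.

Lemma restr_rk_mono (F A B : {set T}) :
  A \subset B -> B \subset F -> (restr_rk F A <= restr_rk F B)%N.
Proof. by move=> sAB _; apply: rk_mono (setSI _ sAB) (subsetIr _ _). Qed.

Lemma restr_rk_submod (F A B : {set T}) : A \subset F -> B \subset F ->
  (restr_rk F (A :|: B) + restr_rk F (A :&: B) <=
   restr_rk F A + restr_rk F B)%N.
Proof.
move=> _ _; rewrite /restr_rk setIUl setIIl.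
exact: rk_submod (subsetIr _ _) (subsetIr _ _).
Qed.

Definition restr (F : {set T}) : matroid F :=
  Matroid (@restr_rk_card F) (@restr_rk_mono F) (@restr_rk_submod F).

Lemma contr_rk_ge (F A : {set T}) : (rk M (F :&: E) <= rk M ((A :|: F) :&: E))%N.
Proof. by apply: rk_mono (subsetIr _ _); apply/setSI/subsetUr. Qed.

Lemma contr_rk_card (F A : {set T}) : A \subset E :\: F -> (contr_rk F A <= #|A|)%N.
Proof.
move=> _; rewrite /contr_rk leq_subLR setIUl.
have := rk_submod M (subsetIr A E) (subsetIr F E).
move/(leq_trans (leq_addr _ _))/leq_trans; apply.
by rewrite addnC leq_add2l (restr_rk_card (subxx A)).
Qed.

Lemma contr_rk_mono (F A B : {set T}) :
  A \subset B -> B \subset E :\: F -> (contr_rk F A <= contr_rk F B)%N.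
Proof.
move=> sAB _; apply/leq_sub2r/rk_mono; last exact: subsetIr.
exact/setSI/setSU.
Qed.

Lemma contr_rk_submod (F A B : {set T}) : A \subset E :\: F -> B \subset E :\: F ->
  (contr_rk F (A :|: B) + contr_rk F (A :&: B) <=
   contr_rk F A + contr_rk F B)%N.
Proof.
move=> _ _; rewrite -(leq_add2r (rk M (F :&: E) + rk M (F :&: E))).
rewrite addnACA [leqRHS]addnACA /contr_rk !subnK ?contr_rk_ge //.
have := rk_submod M (subsetIr (A :|: F) E) (subsetIr (B :|: F) E).
by rewrite -setIUl -setIIl -setUUl -setUIl.
Qed.

Definition contr (F : {set T}) : matroid (E :\: F) :=
  Matroid (@contr_rk_card F) (@contr_rk_mono F) (@contr_rk_submod F).

End Matroids.

Section ChowRing.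
Variables (T : finType) (G : {set T}).

Definition psub : Type := {S : {set T} | (S != set0) && (S \proper G)}.

Notation R := {mpoly rat[#|{: psub}|]}.

Definition chow_var (S : psub) : R := 'X_(enum_rank S).

Definition incomparable (S U : psub) : bool :=
  ~~ (val S \subset val U) && ~~ (val U \subset val S).

Definition linrel (a b : T) : R :=
  \sum_(S : psub | a \in val S) chow_var S
  - \sum_(S : psub | b \in val S) chow_var S.

Definition chow_ideal : R -> bool := fun p =>
  `[< exists (q : psub -> psub -> R) (l : T -> T -> R),
      p = \sum_(S : psub) \sum_(U : psub | incomparable S U)
            q S U * (chow_var S * chow_var U)
        + \sum_(a in G) \sum_(b in G) l a b * linrel a b >].

Lemma chow_ideal_closed : idealr_closed (chow_ideal : {pred R}).
Proof.
have hX S : mcoeff 0%MM (chow_var S) = 0.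
  by rewrite mcoeffX -mdeg_eq0 mdeg1.
have hM p q : mcoeff 0%MM (p * q) = mcoeff 0%MM p * mcoeff 0%MM q :> rat.
  exact: (mcoeff0_is_multiplicative _ _).1.
split.
- rewrite unfold_in; apply/asboolP; exists (fun _ _ => 0), (fun _ _ => 0).
  rewrite !big1 ?addr0 // => a _; rewrite big1 // => b _; exact: mul0r.
- rewrite unfold_in; apply/asboolP => -[q [l /(congr1 (mcoeff 0%MM))]].
  rewrite mcoeffD mcoeff1 eqxx (raddf_sum (mcoeff _)) big1 => [|S _].
    rewrite (raddf_sum (mcoeff _)) big1 => [/eqP|a _].
      by rewrite addr0 oner_eq0.
    rewrite raddf_sum big1 // => b _; rewrite /= hM mcoeffB !raddf_sum.
    by rewrite !big1 ?subr0 ?mulr0 // => S _; rewrite /= hX ?oppr0.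
  by rewrite raddf_sum big1 // => U _; rewrite /= !hM /= !hX !mulr0.
- move=> c u v; rewrite !unfold_in.
  move=> /asboolP[q [l ->]] /asboolP[q' [l' ->]]; apply/asboolP.
  exists (fun S U => c * q S U + q' S U), (fun a b => c * l a b + l' a b).
  rewrite mulrDr addrACA !mulr_sumr -!big_split /=; congr (_ + _);
    apply: eq_bigr => S _; rewrite mulr_sumr -big_split /=;
    by apply: eq_bigr => U _; rewrite mulrDl -mulrA.
Qed.

HB.instance Definition _ := isIdealr.Build R chow_ideal chow_ideal_closed.

Definition chow_idealr : idealr R := chow_ideal.

Definition chow : comNzRingType := {ideal_quot chow_idealr}.

Definition chow_class (p : R) : chow := \pi_({ideal_quot chow_idealr}) p.

Definition x_ (S : psub) : chow := chow_class (chow_var S).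

(* The graded piece CH^d. *)
Definition chow_deg (d : nat) (z : chow) : Prop :=
  exists2 p : R, p \is d.-homog & z = chow_class p.

Definition chain (s : seq psub) : bool :=
  sorted (fun S U : psub => val S \proper val U) s.

(* The degree map, extended by 0 from the top degree #|G| - 1 to the whole
   Chow ring. *)
Record is_degree_map (f : chow -> rat) : Prop := IsDegreeMap {
  degree_linear : forall (c : rat) (z w : chow),
    f (chow_class c%:MP * z + w) = c * f z + f w;
  degree_off_top : forall (d : nat) (z : chow),
    d != #|G|.-1 -> chow_deg d z -> f z = 0;
  degree_top_inj : forall z w : chow,
    chow_deg #|G|.-1 z -> chow_deg #|G|.-1 w -> f z = f w -> z = w;
  degree_flag : forall s : seq psub,
    chain s -> size s = #|G|.-1 -> f (\prod_(S <- s) x_ S) = 1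
}.

Definition integral : chow -> rat :=
  classical_sets.xget (fun=> 0) is_degree_map.

(* [L g i] is the class written $L_i$, for the reference element [g]; note
   that m + 1 = #|G|. *)
Definition L (g : T) (i : nat) : chow :=
  \sum_(S : psub)
    chow_class ((minn (#|G| - i)%N #|val S|)%:R
                - (if g \in val S then (#|G| - i)%N%:R else 0))%:MP * x_ S.

Section BergmanClass.
Variable N : matroid G.

Definition is_bergman_class (z : chow) : Prop :=
  chow_deg (#|G| - mrank N)%N z /\
  forall s : seq psub, chain s -> size s = (mrank N).-1 ->
    integral (z * \prod_(S <- s) x_ S) =
    (if all (fun S : psub => flat N (val S)) s then 1 else 0).

Definition bergman_class : chow :=
  if loopless N then classical_sets.xget 0 is_bergman_class else 0.

(* The exponents are a 1, ..., a (#|G| - 1); other values of [a] are unused. *)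
Definition mixed_eulerian (a : nat -> nat) : rat :=
  if [pick g in G] is Some g
  then integral (bergman_class * \prod_(1 <= i < #|G|) L g i ^+ a i)
  else 0.

End BergmanClass.
End ChowRing.

Definition Bcoef (n i j : nat) : rat :=
  (minn i j)%:R * (n.+1%:R - (maxn i j)%:R) / n.+1%:R.

(* The last condition reads: the sum of a_1, ..., a_{n-|F|} is crk F - 1. *)
Definition Zset (n : nat) (M : matroid [set: 'I_n.+1]) (a : nat -> nat) :
    {set {set 'I_n.+1}} :=
  [set F : {set 'I_n.+1} |
    [&& flat M F, F != set0, F != [set: 'I_n.+1],
        a (n.+1 - #|F|)%N == 0%N &
        ((\sum_(1 <= i < (n - #|F|).+1) a i).+1)%N == crk M F]].

(* Main.v *)
Require Import Defs.
From HB Require Import structures.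
From mathcomp Require Import all_boot all_order all_algebra perm.
From mathcomp Require Import mpoly.
From mathcomp Require Import boolp.
From mathcomp Require classical_sets.
From mathcomp Require Import zify ring lra.

(* Averaging [L g j] over all [g] gives [L_j = sum_S B_(j, n+1-|S|) x_S], so
   everything reduces to the integral of [bergman_class M * x_F * prod_i L_i^(a_i)].
   Modulo linear relations and up to the factor [x_F], each [L_i] becomes a
   class [L_i] of [E \ F] when [i < |E \ F|], zero when [i = |E \ F|], and
   [L_(i - |E \ F|)] of [F] otherwise. The integral then splits as a product
   because a chain of flats of [M] through [F] is a pair of chains of flats of
   [M|F] and [M/F].

   Two existence statements are needed. The degree map is built by
   localization on the permutohedral fan: the integral of [p] is the sum over
   the complete chains [s] of [p(v_s) / prod_(S in s) v_s(S)], where [v_s] lists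
   the values at a generic point of the Courant functions on the cone of [s].
   The Bergman class is the product of the divisors
   [sum_S ([g in S] - [k < nullity S]) x_S] attached to the tower of Higgs lifts
   [A |-> min(rk A + k, |A|)], which joins [M] to the Boolean matroid. *)

Set Implicit Arguments.
Unset Strict Implicit.
Unset Printing Implicit Defensive.

Import GRing.Theory Num.Theory.

Local Open Scope ring_scope.
Local Open Scope quotient_scope.

(** The existence statements are needed because [integral] and [bergman_class] are picked by choice,
    with a default value if nothing qualifies. Their defining properties speak of square-free
    monomials on chains, whereas products of the [L_i] contain arbitrary monomials. Straightening
    carries statements from flags to all monomials; it is stated for a property of elements of any
    commutative ring because it serves in the polynomial ring, in the Chow ring and in a product of
    two rings. On the star of [F] the obstacle is the square of [x_F]. It is avoided by representing
    each [L_i], modulo linear relations, by a function on sets that vanishes at [F]. The factors of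
    the Bergman class come from tropical geometry: consecutive Higgs lifts are elementary quotients,
    each given by a modular cut, and the Bergman fan of a quotient is the divisor that the cut
    defines on the larger fan. *)

Ltac slia := simpl; clear; lia.

(** * Straightening monomials to chains *)

Section Chains.
Variables (T : finType) (G : {set T}).
Implicit Types (S U : psub G) (s : seq (psub G)).

Definition nested S U := ~~ incomparable S U.

(** The unordered counterpart of [chain]: invariant under permutation, as monomials in a commutative
    ring are. *)
Definition flag s := uniq s && all2rel nested s.

Lemma nestedE S U :
  nested S U = (val S \subset val U) || (val U \subset val S).
Proof. by rewrite /nested /incomparable negb_and !negbK. Qed.

Lemma nestedxx S : nested S S.
Proof. by rewrite nestedE subxx. Qed.

Lemma nestedC S U : nested S U = nested U S.
Proof. by rewrite !nestedE orbC. Qed.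

Lemma psub_sub S : val S \subset G.
Proof. by case/andP: (valP S) => _ /proper_sub. Qed.

Lemma psub_neq0 S : val S != set0.
Proof. by case/andP: (valP S). Qed.

Lemma psub_neqG S : val S != G.
Proof. by case/andP: (valP S) => _; rewrite properEneq => /andP[]. Qed.

Lemma psub_card_gt0 S : (0 < #|val S|)%N.
Proof. by rewrite card_gt0 psub_neq0. Qed.

Lemma psub_card_lt S : (#|val S| < #|G|)%N.
Proof. by case/andP: (valP S) => _ /proper_card. Qed.

Lemma all_nestedP s :
  reflect {in s &, forall S U, nested S U} (all2rel nested s).
Proof. exact: allrelP. Qed.

(** The default [set0] for an empty family lets the bound serve as the lower end of a gap in every
    case; [clique_min] has the default [G] for the upper end. *)
Lemma clique_max s : all2rel nested s ->
  exists2 A : {set T}, A = set0 \/ (exists2 S, S \in s & A = val S) &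
    {in s, forall S, val S \subset A}.
Proof.
move/all_nestedP; elim: s => [|S s IHs] cs; first by exists set0 => //; left.
have [|A hA leA] := IHs.
  by move=> U V sU sV; apply: cs; rewrite inE ?sU ?sV orbT.
have [sSA|nSA] := boolP (val S \subset A).
  exists A; last by move=> U; rewrite inE => /orP[/eqP->|/leA].
  by case: hA => [->|[U sU ->]]; [left|right; exists U; rewrite // inE sU orbT].
exists (val S); first by right; exists S; rewrite ?mem_head.
move=> U; rewrite inE => /orP[/eqP->|/leA] // sUA.
case: hA => [A0|[V sV AV]].
  by move: sUA; rewrite A0 subset0 (negbTE (psub_neq0 U)).
apply: subset_trans sUA _; move: (cs S V (mem_head _ _)).
by rewrite inE sV orbT nestedE -AV (negbTE nSA) => /(_ isT).
Qed.

Lemma clique_min s : all2rel nested s ->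
  exists2 A : {set T}, A = G \/ (exists2 S, S \in s & A = val S) &
    {in s, forall S, A \subset val S}.
Proof.
move/all_nestedP; elim: s => [|S s IHs] cs; first by exists G => //; left.
have [|A hA leA] := IHs.
  by move=> U V sU sV; apply: cs; rewrite inE ?sU ?sV orbT.
have [sAS|nAS] := boolP (A \subset val S).
  exists A; last by move=> U; rewrite inE => /orP[/eqP->|/leA].
  by case: hA => [->|[U sU ->]]; [left|right; exists U; rewrite // inE sU orbT].
exists (val S); first by right; exists S; rewrite ?mem_head.
move=> U; rewrite inE => /orP[/eqP->|/leA] // sAU.
case: hA => [AG|[V sV AV]].
  by rewrite AG in sAU; apply: subset_trans (psub_sub S) sAU.
apply: subset_trans _ sAU; move: (cs S V (mem_head _ _)).
by rewrite inE sV orbT nestedE -AV (negbTE nAS) orbF => /(_ isT).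
Qed.

Lemma clique_filter (p : pred (psub G)) s :
  all2rel nested s -> all2rel nested (filter p s).
Proof.
move/all_nestedP=> cs; apply/all_nestedP => S U.
by rewrite !mem_filter => /andP[_ sS] /andP[_ sU]; apply: cs.
Qed.

Lemma flag_chain s : flag s -> exists2 s', perm_eq s s' & chain s'.
Proof.
case/andP=> us /all_nestedP cs.
pose r S U := (#|val S| <= #|val U|)%N.
exists (sort r s); first by rewrite perm_sym perm_sort.
have rt : transitive r by move=> S U V; apply: leq_trans.
have: pairwise r (sort r s).
  by rewrite -sorted_pairwise ?sort_sorted // => S U; apply: leq_total.
rewrite /chain sorted_pairwise => [pr|S U V]; last exact: proper_trans.
have: pairwise (fun S U => S != U) (sort r s) by rewrite -uniq_pairwise sort_uniq.
have {cs}: {in sort r s &, forall S U, nested S U}.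
  by move=> S U; rewrite !mem_sort; apply: cs.
elim: (sort r s) pr => //= S l IHl /andP[rS rl] cs /andP[nS nl].
apply/andP; split; last first.
  by apply: IHl => // U V lU lV; apply: cs; rewrite inE ?lU ?lV orbT.
apply/allP => U lU; rewrite properEneq (inj_eq val_inj) (allP nS) //=.
have := cs S U (mem_head _ _); rewrite inE lU orbT nestedE => /(_ isT).
case/orP=> // sUS; suff -> : val U = val S by [].
by apply/eqP; rewrite eqEcard sUS; apply: (allP rS).
Qed.

Lemma chain_flag s : chain s -> flag s.
Proof.
rewrite /chain sorted_pairwise => [ps|S U V]; last exact: proper_trans.
apply/andP; split.
  rewrite uniq_pairwise; apply: sub_pairwise ps => S U.
  by apply: contraTneq => ->; rewrite properxx.
apply/all_nestedP; elim: s ps => //= S s IHs /andP[pS ps] U V.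
rewrite !inE => /orP[/eqP->|sU] /orP[/eqP->|sV]; first exact: nestedxx.
- by rewrite nestedE (proper_sub (allP pS _ sV)).
- by rewrite nestedE (proper_sub (allP pS _ sU)) orbT.
- exact: IHs.
Qed.

Lemma flag_consP S s : reflect
  [/\ S \notin s, {in s, forall U, nested S U} & flag s] (flag (S :: s)).
Proof.
rewrite /flag /=; apply: (iffP andP) => [[/andP[nS us] /all_nestedP cs]|].
  split=> //; first by move=> U sU; apply: cs; rewrite inE ?sU ?eqxx ?orbT.
  rewrite us; apply/all_nestedP => U V sU sV.
  by apply: cs; rewrite inE ?sU ?sV orbT.
case=> nS cS /andP[us /all_nestedP cs]; split; first by rewrite nS.
apply/all_nestedP => U V; rewrite !inE.
case/orP=> [/eqP->|sU] /orP[/eqP->|sV]; first exact: nestedxx.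
- exact: cS.
- by rewrite nestedC; apply: cS.
- exact: cs.
Qed.

End Chains.

Section Straightening.
Variables (T : finType) (G : {set T}) (R : comNzRingType) (X : psub G -> R).
Variable P : R -> Prop.
Variable d : nat.
Implicit Types (S U : psub G) (s : seq (psub G)).

Definition lrel (a b : T) : R :=
  \sum_(S : psub G | a \in val S) X S - \sum_(S : psub G | b \in val S) X S.

Lemma lrelE a b :
  lrel a b = \sum_(S : psub G) ((a \in val S)%:R - (b \in val S)%:R) * X S.
Proof.
rewrite /lrel big_mkcond [Y in _ - Y]big_mkcond -sumrB /=; apply: eq_bigr => S _.
by rewrite mulrBl; do 2 case: (_ \in _); rewrite ?mul1r ?mul0r.
Qed.

Hypothesis P0 : P 0.
Hypothesis PB : forall r r', P r -> P r' -> P (r - r').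
Hypothesis Pinc : forall S U s, incomparable S U -> (size s).+2 = d ->
  P (X S * X U * \prod_(V <- s) X V).
Hypothesis Plin : forall a b s, a \in G -> b \in G -> (size s).+1 = d ->
  P (lrel a b * \prod_(V <- s) X V).
Hypothesis Pflag : forall s, flag s -> size s = d -> P (\prod_(V <- s) X V).

Let PD r r' : P r -> P r' -> P (r + r').
Proof. by move=> Pr Pr'; rewrite -[r']opprK -[- r']sub0r; auto. Qed.

Let Psum (I : finType) (p : pred I) (F : I -> R) :
  (forall i, p i -> P (F i)) -> P (\sum_(i | p i) F i).
Proof. by move=> PF; apply: (big_ind P). Qed.

(* Induction on the number of repetitions in [s]: a repeated [F] is traded,
   by the linear relation of [a] and [b], for sets not in [s], where
   [a \in F] avoids the smaller members of [s] and [b \notin F] lies in all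
   the larger ones. *)
Lemma straighten s : size s = d -> P (\prod_(V <- s) X V).
Proof.
have [e] := ubnP (size s - size (undup s)); elim: e s => // e IHe s.
rewrite ltnS => le_e szs.
have [cs|/allPn[S sS /allPn[U sU nSU]]] := boolP (all2rel (@nested _ G) s);
  last first.
  have iSU : incomparable S U by rewrite negbK in nSU.
  have neSU : U != S by apply: contraNneq nSU => ->; apply: nestedxx.
  have sU' : U \in rem S s by apply: contraLR sU; case: eqVneq neSU => // neUS _ nU;
    rewrite (perm_mem (perm_to_rem sS)) inE negb_or neUS.
  have ps : perm_eq s (S :: U :: rem U (rem S s)).
    by rewrite (perm_trans (perm_to_rem sS)) // perm_cons perm_to_rem.
  rewrite (perm_big _ ps) /= !big_cons mulrA; apply: Pinc => //.
  by rewrite -szs (perm_size ps).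
have [us|nus] := boolP (uniq s); first by apply: Pflag; rewrite // /flag us.
have [F sF cF] : exists2 F, F \in s & F \in rem F s.
  elim: s nus {IHe le_e szs cs} => //= F s IHs.
  rewrite negb_and negbK; have [sF _|_ /= /IHs[S sS rS]] := boolP (F \in s).
    by exists F; rewrite ?inE ?eqxx.
  by exists S; rewrite ?inE ?sS ?orbT //; case: ifP => // _; rewrite inE rS orbT.
pose s1 := rem F s.
have ps : perm_eq s (F :: s1) by apply: perm_to_rem.
have sz1 : (size s1).+1 = d by rewrite -szs (perm_size ps).
have s1E : s1 =i s.
  move=> S; rewrite (perm_mem ps) inE.
  by case: eqVneq => // ->.
have cFs S : S \in s -> nested F S by move=> sS; apply: (all_nestedP _ cs).
have [a Fa aP] : exists2 a, a \in val F &
    forall S, S \in s -> val S \proper val F -> a \notin val S.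
  have [A hA leA] := clique_max (clique_filter (fun S => val S \proper val F) cs).
  have /properP[_ [a Fa nAa]] : A \proper val F.
    case: hA => [->|[S + ->]]; first by rewrite proper0 psub_neq0.
    by rewrite mem_filter => /andP[].
  exists a => // S sS pS; apply: contra nAa; apply/subsetP/leA.
  by rewrite mem_filter pS.
have [b Gb [nFb bP]] : exists2 b, b \in G & b \notin val F /\
    forall S, S \in s -> val F \proper val S -> b \in val S.
  have [A hA leA] := clique_min (clique_filter (fun S => val F \proper val S) cs).
  have /properP[_ [b Ab nFb]] : val F \proper A.
    case: hA => [->|[S + ->]]; first by case/andP: (valP F).
    by rewrite mem_filter => /andP[].
  have AG : A \subset G by case: hA => [->|[S _ ->]]; rewrite ?psub_sub.
  exists b; first exact: (subsetP AG).
  split=> // S sS pS; apply: (subsetP (leA S _)) => //.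
  by rewrite mem_filter pS.
have Ga : a \in G by apply: (subsetP (psub_sub F)).
have := Plin Ga Gb sz1; rewrite lrelE (bigD1 F) //= Fa (negbTE nFb) subr0 mul1r.
have prodE : \prod_(V <- s) X V = X F * \prod_(V <- s1) X V.
  by rewrite (perm_big _ ps) /= big_cons.
rewrite mulrDl -prodE => PF.
rewrite -[\prod_(V <- s) X V]addr0 -(subrr ((\sum_(S : psub G | S != F)
  ((a \in val S)%:R - (b \in val S)%:R) * X S) * \prod_(V <- s1) X V)) addrA.
apply: PB => //; rewrite mulr_suml; apply: Psum => S neSF.
have [sS|nsS] := boolP (S \in s).
  have := cFs S sS; rewrite nestedE => /orP[sFS|sSF].
    have pFS : val F \proper val S by rewrite properEneq sFS eq_sym (inj_eq val_inj) neSF.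
    by rewrite (bP _ sS pFS) (subsetP sFS) // subrr !mul0r.
  have pSF : val S \proper val F by rewrite properEneq sSF (inj_eq val_inj) neSF.
  rewrite (negbTE (aP _ sS pSF)); have [Sb|] := boolP (b \in val S).
    by rewrite (subsetP sSF) in nFb.
  by rewrite subrr !mul0r.
have PS : P (X S * \prod_(V <- s1) X V).
  rewrite -(big_cons 1 *%R S s1 xpredT X); apply: IHe => //=.
  have eqs : size (undup s1) = size (undup s).
    apply/eqP; rewrite -uniq_size_uniq ?undup_uniq // => V.
    by rewrite !mem_undup s1E.
  rewrite s1E (negbTE nsS) /= eqs.
  have := size_undup s1; rewrite eqs.
  move: le_e; rewrite (perm_size ps) /= => le_e ge_e.
  by apply: leq_trans le_e; rewrite subSS subSn.
rewrite -mulrA.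
by do 2 case: (_ \in _);
  rewrite ?subrr ?subr0 ?sub0r ?mul0r ?mulN1r ?mul1r // -sub0r; apply: PB.
Qed.

End Straightening.

(** Multilinear expansion, one factor at a time: the auxiliary claim carries the list [s] of
    variables chosen so far. *)
Lemma prod_linear_forms (T : finType) (G : {set T}) (R : comNzRingType)
    (X : psub G -> R) (k : rat -> R) (P : R -> Prop) (d : nat) :
  P 0 -> (forall r r', P r -> P r' -> P (r + r')) ->
  (forall c r, P r -> P (k c * r)) ->
  (forall s, size s = d -> P (\prod_(S <- s) X S)) ->
  forall l : seq (psub G -> rat), size l = d ->
    P (\prod_(f <- l) \sum_(S : psub G) k (f S) * X S).
Proof.
move=> P0 PD PZ PX l szl.
suff gen s : (size s + size l)%N = d ->
    P (\prod_(S <- s) X S * \prod_(f <- l) \sum_(S : psub G) k (f S) * X S).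
  by have := gen [::] szl; rewrite big_nil mul1r.
elim: l s {szl} => [|f l IHl] s szl.
  by rewrite big_nil mulr1; apply: PX; rewrite -szl addn0.
rewrite big_cons mulrCA mulr_suml; apply: (big_ind P) => // S _.
rewrite -mulrA; apply: PZ; rewrite mulrA -(big_cons 1 *%R S s xpredT X).
by apply: IHl; rewrite -szl /= addnS.
Qed.

(** * The relations of the Chow ring *)

Section ChowBasics.
Variables (T : finType) (G : {set T}).
Notation R := {mpoly rat[#|{: psub G}|]}.
Notation chow_class := (@chow_class T G).

HB.instance Definition _ :=
  GRing.RMorphism.copy chow_class (\pi_({ideal_quot (chow_idealr G)})).

Definition chow_scalar (c : rat) : chow G := chow_class c%:MP.

HB.instance Definition _ :=
  GRing.RMorphism.copy chow_scalar (chow_class \o @mpolyC _ rat).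

Lemma chow_class_eq0 p : (chow_class p == 0) = chow_ideal p.
Proof.
rewrite -(raddf0 chow_class).
have := Quotient.idealrBE (chow_idealr G) p 0.
by rewrite subr0 => <-.
Qed.

Lemma chow_reprK z : chow_class (repr z) = z.
Proof. exact: reprK. Qed.

Lemma x_incomparable (S U : psub G) : incomparable S U -> x_ S * x_ U = 0.
Proof.
move=> iSU; rewrite /x_ -rmorphM; apply/eqP; rewrite chow_class_eq0.
apply/asboolP; exists (fun S' U' => if (S' == S) && (U' == U) then 1 else 0), (fun _ _ => 0).
rewrite [X in _ + X]big1 ?addr0 => [|a _]; last first.
  by rewrite big1 // => b _; rewrite mul0r.
rewrite (bigD1 S) //= (bigD1 U) //= !eqxx mul1r !big1 ?addr0 // => V.
  by move=> neVS; rewrite big1 // => W _; rewrite (negbTE neVS) mul0r.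
by case/andP=> _ /negbTE->; rewrite mul0r.
Qed.

Lemma x_lrel (a b : T) : a \in G -> b \in G -> lrel (@x_ T G) a b = 0.
Proof.
move=> Ga Gb; have -> : lrel (@x_ T G) a b = chow_class (linrel G a b).
  by rewrite /lrel /linrel rmorphB !rmorph_sum.
apply/eqP; rewrite chow_class_eq0.
apply/asboolP; exists (fun _ _ => 0), (fun a' b' => if (a' == a) && (b' == b) then 1 else 0).
rewrite [X in X + _]big1 ?add0r => [|S _]; last first.
  by rewrite big1 // => U _; rewrite mul0r.
rewrite (bigD1 a) //= (bigD1 b) //= !eqxx mul1r !big1 ?addr0 // => c.
  by case/andP=> _ neca; rewrite big1 // => W _; rewrite (negbTE neca) mul0r.
by case/andP=> _ /negbTE->; rewrite mul0r.
Qed.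

End ChowBasics.

(** * The degree map by localization *)

Section Localization.
Variables (T : finType) (G : {set T}).
Notation R := {mpoly rat[#|{: psub G}|]}.
Notation m := #|G|.-1.
Implicit Types (S U : psub G) (s : seq (psub G)).

(** The sets of a chain that omit [a] precede those that contain it, so their number is the position
    where [a] enters. *)
Lemma chain_mem_count s i (S0 : psub G) a : chain s -> (i < size s)%N ->
  (a \in val (nth S0 s i)) = (count (fun S => a \notin val S) s <= i)%N.
Proof.
rewrite /chain sorted_pairwise => [|S U V]; last exact: proper_trans.
elim: s i => //= S s IHs i /andP[/allP pS ps] lt_i.
have [aS|naS] /= := boolP (a \in val S).
  rewrite (@eq_in_count _ _ pred0) ?count_pred0 => [|U /pS/proper_sub sSU].
    case: i lt_i => //= i; rewrite ltnS => lt_i.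
    by rewrite (subsetP (proper_sub (pS _ (mem_nth _ lt_i)))).
  by rewrite (subsetP sSU).
rewrite add1n; case: i lt_i => [_|i lt_i] /=; first by rewrite (negbTE naS).
exact: IHs.
Qed.

Variable s : seq (psub G).
Hypothesis chain_s : chain s.
Hypothesis size_s : size s = m.

Lemma complete_chain_cards : map (fun S : psub G => #|val S|) s = iota 1 m.
Proof.
have ss : sorted ltn (map (fun S : psub G => #|val S|) s).
  rewrite sorted_map; apply: sub_sorted chain_s => S U; exact: proper_card.
apply: (irr_sorted_eq ltn_trans ltnn ss (iota_ltn_sorted _ _)).
apply: (uniq_min_size _ _ _).2; first exact: sorted_uniq ltn_trans ltnn _ ss.
  move=> k /mapP[S _ ->]; rewrite mem_iota psub_card_gt0 /=.
  by have := psub_card_lt S; case: #|G|.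
by rewrite size_iota size_map size_s.
Qed.

(** A complete chain amounts to a total order on [G]; this is the position of [a], counted from
    0. *)
Definition rank_of (a : T) := count (fun S : psub G => a \notin val S) s.

Lemma mem_complete_chain S a :
  S \in s -> (a \in val S) = (rank_of a < #|val S|)%N.
Proof.
move=> sS; have := chain_mem_count S a chain_s (etrans (index_mem _ _) sS).
rewrite nth_index // => ->.
have := congr1 (fun l => nth 0%N l (index S s)) complete_chain_cards.
have lt_i : (index S s < m)%N by rewrite -size_s index_mem.
by rewrite (nth_map S) ?index_mem // nth_index // nth_iota // add1n => ->.
Qed.

Lemma card_rank_lt k : (k <= #|G|)%N -> #|[set a in G | (rank_of a < k)%N]| = k.
Proof.
case: k => [|k] le_k; first by apply: eq_card0 => a; rewrite inE ltn0 andbF.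
have [lt_k|ge_k] := ltnP k m.
  have : k.+1 \in iota 1 m by rewrite mem_iota.
  rewrite -complete_chain_cards => /mapP[S sS ->].
  congr #|pred_of_set _|; apply/setP => a; rewrite inE -mem_complete_chain //.
  by apply: andb_idl; apply: (subsetP (psub_sub S)).
have -> : k.+1 = #|G| by lia.
congr #|pred_of_set _|; apply/setP => a; rewrite inE; apply: andb_idr => Ga.
by apply: leq_ltn_trans (count_size _ _) _; rewrite size_s; lia.
Qed.

Lemma card_rank_eq k : (k < #|G|)%N -> #|[set a in G | rank_of a == k]| = 1%N.
Proof.
move=> lt_k; pose A := [set a in G | (rank_of a < k)%N].
have -> : [set a in G | rank_of a == k] = [set a in G | (rank_of a < k.+1)%N] :\: A.
  by apply/setP => a; rewrite !inE ltnS; case: (a \in G); case: ltngtP.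
have sA : A \subset [set a in G | (rank_of a < k.+1)%N].
  by apply/subsetP => a; rewrite !inE => /andP[-> /ltnW].
by rewrite cardsDS // !card_rank_lt // ?subSnn // ltnW.
Qed.

Variable t : T -> rat.

(** The value of [t] at the element in position [k]: for [k] below [#|G|] the sum has one term, and
    no inverse of [rank_of] has to be named. *)
Definition coord k := \sum_(a in G | rank_of a == k) t a.

Lemma coord_rank k : (k < #|G|)%N ->
  exists a, [/\ a \in G, rank_of a = k & coord k = t a].
Proof.
move=> /card_rank_eq/eqP/cards1P[a /setP aP]; exists a.
have := aP a; rewrite !inE eqxx => /andP[Ga /eqP ra]; split=> //.
rewrite /coord (big_pred1 a) // => b; have := aP b.
by rewrite !inE => <-.
Qed.

Lemma coord_rank_of a : a \in G -> coord (rank_of a) = t a.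
Proof.
move=> Ga; have lt_a : (rank_of a < #|G|)%N.
  apply: leq_ltn_trans (count_size _ _) _; rewrite size_s prednK //.
  by rewrite card_gt0; apply/set0Pn; exists a.
have /eqP/cards1P[b /setP bP] := card_rank_eq lt_a.
rewrite /coord (big_pred1 a) // => c; have := bP c; rewrite !inE => ->.
by have := bP a; rewrite !inE Ga eqxx => /esym/eqP->.
Qed.

(* The Courant function of the ray of [S], restricted to the maximal cone of
   [s] and evaluated at the point [t]. *)
Definition courant S : rat :=
  if S \in s then coord #|val S|.-1 - coord #|val S| else 0.

Lemma courant_eq0 S : S \notin s -> courant S = 0.
Proof. by rewrite /courant => /negbTE->. Qed.

Lemma courant_neq0 S : {in G &, injective t} -> S \in s -> courant S != 0.
Proof.
move=> inj_t sS; rewrite /courant sS subr_eq0.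
have lt0 := psub_card_gt0 S; have ltG := psub_card_lt S.
have [a [Ga ra ->]] := coord_rank (leq_ltn_trans (leq_pred _) ltG).
have [b [Gb rb ->]] := coord_rank ltG.
by apply/eqP => /inj_t eab; move: rb; rewrite -eab // ra; lia.
Qed.

Lemma courant_incomparable S U : incomparable S U -> courant S * courant U = 0.
Proof.
move=> iSU; rewrite /courant; case: ifP => sS; last by rewrite mul0r.
case: ifP => sU; last by rewrite mulr0.
have /andP[_ /all_nestedP cs] := chain_flag chain_s.
by have := cs _ _ sS sU; rewrite /nested iSU.
Qed.

(** The sum telescopes. The term [coord m] depends on the chain but not on [a], so the linear
    relation of [a] and [b] takes the same value [t a - t b] on every maximal cone. *)
Lemma courant_sum a : a \in G ->
  \sum_(S : psub G | a \in val S) courant S = t a - coord m.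
Proof.
move=> Ga; rewrite -(coord_rank_of Ga).
have us : uniq s by have /andP[] := chain_flag chain_s.
have -> : \sum_(S : psub G | a \in val S) courant S =
    \sum_(S <- s | (rank_of a < #|val S|)%N) (coord #|val S|.-1 - coord #|val S|).
  rewrite [RHS]big_mkcond big_uniq //= [LHS]big_mkcond [RHS]big_mkcond /=.
  apply: eq_bigr => S _; rewrite /courant; case: ifP => aS; case: ifP => sS //=.
  - by rewrite -mem_complete_chain ?aS.
  - by rewrite -mem_complete_chain ?aS.
rewrite -(big_map (fun S : psub G => #|val S|) (fun k => rank_of a < k)%N
            (fun k => coord k.-1 - coord k)) complete_chain_cards.
have le_a : (rank_of a <= m)%N by rewrite -size_s count_size.
have tel j n : \sum_(k <- iota j.+1 n) (coord k.-1 - coord k) = coord j - coord (j + n)%N.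
  elim: n j => [|n IHn] j /=; first by rewrite big_nil addn0 subrr.
  by rewrite big_cons IHn addSnnS addrA subrK.
have -> : iota 1 m = iota 1 (rank_of a) ++ iota (rank_of a).+1 (m - rank_of a).
  by rewrite -add1n -iotaD subnKC.
rewrite big_cat /= big_seq_cond big1 ?add0r; last by move=> k; rewrite mem_iota; lia.
rewrite big_seq_cond (eq_bigl (fun k => k \in iota (rank_of a).+1 (m - rank_of a))).
  by rewrite -big_seq tel subnKC.
by move=> k; rewrite mem_iota; lia.
Qed.

End Localization.

Section Degree.
Variables (T : finType) (G : {set T}).
Notation R := {mpoly rat[#|{: psub G}|]}.
Notation m := #|G|.-1.
Notation Xv := (@chow_var T G).
Implicit Types (S U : psub G) (s : seq (psub G)).

(** For nested sets, the number of members that contain [a] determines which ones do. It takes at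
    most [size s + 1] values, fewer than [#|G|]: pigeonhole. *)
Lemma flag_gap s : flag s -> (size s < m)%N ->
  exists a b, [/\ a \in G, b \in G, a != b &
    {in s, forall S, (a \in val S) = (b \in val S)}].
Proof.
move=> /andP[_ /all_nestedP cs] lt_s.
pose c a := count (fun S => a \in val S) s.
have cP a b S : S \in s -> c a = c b -> a \in val S -> b \in val S.
  move=> sS eq_c aS; apply: contra_eqT eq_c => nbS.
  have sub : {in s, forall U, (b \in val U) = (b \in val U) && (a \in val U)}.
    move=> U sU; rewrite andbC; symmetry; apply: andb_idl => bU.
    have := cs S U sS sU; rewrite nestedE => /orP[/subsetP->//|/subsetP sUS].
    by rewrite sUS in nbS.
  rewrite /c (eq_in_count sub) !(seq.permP (perm_to_rem sS)) /= aS (negbTE nbS).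
  rewrite neq_ltn; apply/orP; right; rewrite add0n add1n ltnS.
  by apply: sub_count => U /= /andP[].
pose f a : 'I_(size s).+1 := inord (c a).
have fP a b : f a = f b -> c a = c b.
  by move/(congr1 (@nat_of_ord _)); rewrite /f !inordK ?ltnS ?count_size.
have [/injectiveP inj|] := boolP (injectiveb (fun a : {x in G} => f (val a))).
  have := leq_card _ inj; rewrite card_ord card_sig.
  by rewrite (eq_card (B := G)) //; lia.
case/injectivePn=> -[a Ga] [[b Gb] neab /fP /= cab]; exists a, b; split=> //.
by move=> S sS; apply/idP/idP; apply: cP.
Qed.

Lemma tpermS_subproof (a b : T) S : a \in G -> b \in G ->
  (tperm a b @: val S != set0) && (tperm a b @: val S \proper G).
Proof.
move=> Ga Gb; rewrite imset_eq0 psub_neq0 properEcard.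
rewrite card_imset ?psub_card_lt ?andbT; last exact: perm_inj.
apply/subsetP => _ /imsetP[x /(subsetP (psub_sub S)) Gx ->].
by case: tpermP.
Qed.

(** Distinct coordinates keep the denominators of the localization non-zero. *)
Definition generic_point (a : T) : rat := (enum_rank a)%:R.

Lemma generic_point_inj : injective generic_point.
Proof. by move=> a b /eqP; rewrite eqr_nat => /eqP/val_inj/enum_rank_inj. Qed.

Definition courant_eval s (p : R) : rat :=
  p.@[fun i => courant s generic_point (enum_val i)].

HB.instance Definition _ s := GRing.RMorphism.copy (courant_eval s)
  (meval (fun i => courant s generic_point (enum_val i))).

Lemma courant_evalX s S : courant_eval s (Xv S) = courant s generic_point S.
Proof. by rewrite /courant_eval mevalXU enum_rankK. Qed.

Definition localization (p : R) : rat :=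
  \sum_(s : m.-tuple (psub G) | chain s)
     courant_eval s p / \prod_(S <- s) courant s generic_point S.

Lemma localizationD p q : localization (p + q) = localization p + localization q.
Proof.
rewrite /localization -big_split /=; apply: eq_bigr => s _.
by rewrite rmorphD mulrDl.
Qed.

Lemma localization0 : localization 0 = 0.
Proof. by rewrite /localization big1 // => s _; rewrite rmorph0 mul0r. Qed.

Lemma localizationZ c p : localization (c *: p) = c * localization p.
Proof.
rewrite /localization mulr_sumr; apply: eq_bigr => s _.
by rewrite /courant_eval mevalZ mulrA.
Qed.

Lemma localizationB p q : localization (p - q) = localization p - localization q.
Proof. by rewrite -scaleN1r localizationD localizationZ mulN1r. Qed.

Lemma localization_sum (I : finType) (P : pred I) (F : I -> R) :
  localization (\sum_(i | P i) F i) = \sum_(i | P i) localization (F i).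
Proof. exact: (big_morph _ localizationD localization0). Qed.

Lemma localization_incomparable S U p :
  incomparable S U -> localization (Xv S * Xv U * p) = 0.
Proof.
move=> iSU; rewrite /localization big1 // => s cs.
by rewrite !rmorphM /= !courant_evalX courant_incomparable // !mul0r.
Qed.

(** In the equivariant setting a linear relation is a number instead of 0. The relation still holds
    in degree [m], because the cofactor then has degree [m - 1], where [localization_low]
    applies. *)
Lemma localization_lrel a b p : a \in G -> b \in G ->
  localization (lrel Xv a b * p) =
  (generic_point a - generic_point b) * localization p.
Proof.
move=> Ga Gb; rewrite /localization mulr_sumr; apply: eq_bigr => s cs.
rewrite rmorphM mulrA; congr (_ * _ / _); rewrite /lrel rmorphB !rmorph_sum /=.
have E c : \sum_(S : psub G | c \in val S) courant_eval s (Xv S) =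
    \sum_(S : psub G | c \in val S) courant s generic_point S.
  by apply: eq_bigr => S _; rewrite courant_evalX.
rewrite !E.
rewrite !courant_sum ?size_tuple //; lra.
Qed.

Lemma localization_flag s : flag s -> size s = m ->
  localization (\prod_(S <- s) Xv S) = 1.
Proof.
move=> /flag_chain[s' ps cs'] szs.
have szs' : size s' == m by rewrite -(perm_size ps) szs.
rewrite (perm_big _ ps) /= /localization (bigD1 (Tuple szs')) //= [X in _ + X]big1 ?addr0.
  rewrite rmorph_prod /=; under eq_bigr do rewrite courant_evalX.
  rewrite divff // prodf_seq_neq0; apply/allP => S sS /=.
  by apply: courant_neq0 => //; [exact/eqP|move=> a b _ _; apply: generic_point_inj].
(* Any other complete chain misses a member of [s'], whose Courant function vanishes on its cone. *)
move=> s1 /andP[cs1 nes1]; have /allPn[S sS nS] : ~~ all (mem s1) s'.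
  apply: contra nes1 => /allP sub; rewrite -val_eqE /=; apply/eqP/esym.
  have [us' us1] : uniq s' /\ uniq s1.
    by split; [have /andP[] := chain_flag cs'|have /andP[] := chain_flag cs1].
  apply: (@irr_sorted_eq _ (fun S U : psub G => val S \proper val U)) => //.
  - by move=> ? ? ?; apply: proper_trans.
  - by move=> ?; apply: properxx.
  by apply: (uniq_min_size us' sub _).2; rewrite size_tuple (eqP szs').
rewrite rmorph_prod /= (big_rem S) //= courant_evalX courant_eq0 ?mul0r //.
Qed.

Lemma localization_nonflag s S : flag s -> S \notin s -> ~~ flag (S :: s) ->
  localization (Xv S * \prod_(U <- s) Xv U) = 0.
Proof.
move=> fs nS nf; have /allPn[U sU] : ~~ all (nested S) s.
  by apply: contra nf => /allP cS; apply/flag_consP.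
rewrite negbK => iSU; rewrite (big_rem U) //= mulrA.
exact: localization_incomparable.
Qed.

(** The transposition of [a] and [b] fixes the members of [s] and permutes the sets completing [s]
    to a flag, each of which has localization 1. It reverses the sign of every coefficient, so the
    sum equals its opposite. *)
Lemma localization_gap s a b : a \in G -> b \in G -> flag s -> (size s).+1 = m ->
  {in s, forall S, (a \in val S) = (b \in val S)} ->
  \sum_(S : psub G) ((a \in val S)%:R - (b \in val S)%:R) *
    localization (Xv S * \prod_(U <- s) Xv U) = 0.
Proof.
move=> Ga Gb fs szs eq_ab.
pose sw S : psub G := Sub (tperm a b @: val S) (tpermS_subproof S Ga Gb).
have valsw S x : (x \in val (sw S)) = (tperm a b x \in val S).
  rewrite /= -[x in LHS](tpermK a b) mem_imset //; exact: perm_inj.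
have swK : involutive sw.
  by move=> S; apply/val_inj/setP => x; rewrite !valsw tpermK.
have sw_s : {in s, forall S, sw S = S}.
  move=> S sS; apply/val_inj/setP => x; rewrite valsw.
  by case: tpermP => // ->; rewrite eq_ab.
have sw_flag S : flag (S :: s) -> flag (sw S :: s).
  case/flag_consP=> nS cS _; apply/flag_consP; split=> //.
    by apply: contra nS => sS; rewrite -[S]swK (sw_s _ sS).
  move=> U sU; rewrite -(sw_s _ sU) nestedE; have := cS U sU; rewrite nestedE /=.
  by case/orP=> sSU; apply/orP; [left|right]; apply: imsetS.
have sw_loc S : localization (Xv (sw S) * \prod_(U <- s) Xv U) =
                localization (Xv S * \prod_(U <- s) Xv U).
  have [sS|nS] := boolP (S \in s); first by rewrite sw_s.
  have [fS|nfS] := boolP (flag (S :: s)).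
    have := localization_flag fS szs; have := localization_flag (sw_flag S fS) szs.
    by rewrite !big_cons => -> ->.
  rewrite !localization_nonflag //.
    by apply: contra nS => sS; rewrite -[S]swK (sw_s _ sS).
  by apply: contra nfS => /sw_flag; rewrite swK.
set lhs := LHS; suff: lhs = - lhs by lra.
rewrite {1}/lhs (reindex_inj (inv_inj swK)) /= -sumrN; apply: eq_bigr => S _.
by rewrite sw_loc !valsw tpermL tpermR -mulNr opprB.
Qed.

(* In degree [d] this is the equivariant integral, a polynomial in [t] of degree
   [d - m]. *)
Lemma localization_low s : (size s < m)%N -> localization (\prod_(S <- s) Xv S) = 0.
Proof.
(* Induction on the degree: a linear relation met in straightening multiplies the localization of a
   shorter monomial. *)
have [d] := ubnP (size s); elim: d s => // d IHd s; rewrite ltnS => le_d lt_s.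
apply: (@straighten _ _ _ Xv (fun p => localization p = 0) (size s)) => //.
- exact: localization0.
- by move=> p q; rewrite localizationB => -> ->; rewrite subr0.
- by move=> *; apply: localization_incomparable.
- move=> a b s' Ga Gb szs'; rewrite localization_lrel // IHd ?mulr0 //; lia.
move=> {IHd le_d} s' + szs'; rewrite -szs' in lt_s; move: lt_s => {s szs'}.
(* For flags, descending induction on the length. The relation of two elements that [s] does not
   separate acts by a non-zero number, while its expansion only involves sets that lengthen [s]. *)
have [e] := ubnP (m - size s'); elim: e s' => // e IHe s; rewrite ltnS => le_e lt_s fs.
have [a [b [Ga Gb neab eq_ab]]] := flag_gap fs lt_s.
have : (generic_point a - generic_point b) * localization (\prod_(V <- s) Xv V) = 0.
  rewrite -localization_lrel // lrelE mulr_suml localization_sum.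
  have E S : localization (((a \in val S)%:R - (b \in val S)%:R) * Xv S * \prod_(V <- s) Xv V)
    = ((a \in val S)%:R - (b \in val S)%:R) * localization (Xv S * \prod_(V <- s) Xv V).
    by rewrite -mulrA -localizationZ -mul_mpolyC mpolyCB !mpolyC_nat.
  rewrite (eq_bigr _ (fun S _ => E S)).
  have [szs|] := eqVneq (size s).+1 m; first exact: localization_gap.
  move=> nszs; rewrite big1 // => S _.
  have [sS|nS] := boolP (S \in s); first by rewrite eq_ab // subrr mul0r.
  have [fS|nfS] := boolP (flag (S :: s)); last by rewrite localization_nonflag ?mulr0.
  by rewrite -(big_cons 1 *%R S s xpredT Xv) IHe ?mulr0 //=; lia.
move/eqP; rewrite mulf_eq0 subr_eq0 => /orP[/eqP/generic_point_inj eab|/eqP//].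
by rewrite eab eqxx in neab.
Qed.

End Degree.

Section DegreeMap.
Variables (T : finType) (G : {set T}).
Notation R := {mpoly rat[#|{: psub G}|]}.
Notation m := #|G|.-1.
Notation Xv := (@chow_var T G).
Implicit Types (S U : psub G) (s : seq (psub G)).

Lemma monomial_prod (mm : 'X_{1..#|{: psub G}|}) :
  exists2 s, size s = mdeg mm & 'X_[mm] = \prod_(S <- s) Xv S :> R.
Proof.
have prod_nseq k S : \prod_(U <- nseq k S) Xv U = Xv S ^+ k.
  by elim: k => [|k IHk]; rewrite ?big_nil //= big_cons IHk exprS.
rewrite mpolyXE_id mdegE; elim: (index_enum _) => [|i l [s szs IHl]].
  by exists [::]; rewrite ?big_nil.
exists (nseq (mm i) (enum_val i) ++ s).
  by rewrite size_cat size_nseq szs big_cons.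
by rewrite big_cat big_cons IHl /= prod_nseq /chow_var enum_valK.
Qed.

Lemma homog_span (P : R -> Prop) d p :
  P 0 -> (forall p q, P p -> P q -> P (p + q)) -> (forall c p, P p -> P (c *: p)) ->
  (forall s, size s = d -> P (\prod_(S <- s) Xv S)) ->
  p \is d.-homog -> P p.
Proof.
move=> P0 PD PZ PX /dhomogP hp; rewrite [p]mpolyE big_seq.
apply: (big_ind P) => // mm /hp dmm; apply: PZ.
by have [s szs ->] := monomial_prod mm; apply: PX; rewrite szs.
Qed.

Lemma prod_var_homog s : \prod_(S <- s) Xv S \is (size s).-homog.
Proof.
elim: s => [|S s IHs]; first by rewrite big_nil; apply: dhomog1.
rewrite big_cons -[size _]/(1 + size s)%N.
by apply: dhomogM => //; rewrite dhomogX /= mdeg1.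
Qed.

(** Above degree [m] the localization need not vanish, so the component of degree [m] is extracted
    beforehand. *)
Definition top_degree (p : R) : rat := localization (pihomog mdeg m p).

Lemma top_degreeP c p q : top_degree (c *: p + q) = c * top_degree p + top_degree q.
Proof. by rewrite /top_degree linearP localizationD localizationZ. Qed.

Lemma top_degree0 : top_degree 0 = 0.
Proof. by rewrite /top_degree linear0 localization0. Qed.

Lemma top_degreeD p q : top_degree (p + q) = top_degree p + top_degree q.
Proof. by rewrite -[p in LHS]scale1r top_degreeP mul1r. Qed.

Lemma top_degreeZ c p : top_degree (c *: p) = c * top_degree p.
Proof. by rewrite -[c *: p]addr0 top_degreeP top_degree0 addr0. Qed.

Lemma top_degree_sum (I : finType) (P : pred I) (F : I -> R) :
  top_degree (\sum_(i | P i) F i) = \sum_(i | P i) top_degree (F i).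
Proof. exact: (big_morph _ top_degreeD top_degree0). Qed.

Lemma top_degree_homog d p : p \is d.-homog ->
  top_degree p = if d == m then localization p else 0.
Proof.
move=> hp; rewrite /top_degree; case: eqVneq => [<-|ne]; first by rewrite pihomog_dE.
by rewrite (pihomog_ne0 ne hp) localization0.
Qed.

Lemma top_degree_mul_eq0 q r d : r \is d.-homog ->
  (forall s, (size s + d)%N = m -> localization (r * \prod_(S <- s) Xv S) = 0) ->
  top_degree (q * r) = 0.
Proof.
move=> hr loc0; rewrite [q]mpolyE mulr_suml.
apply: (big_ind (fun p => top_degree p = 0)).
- exact: top_degree0.
- by move=> p p' p0 p'0; rewrite top_degreeD p0 p'0 addr0.
move=> mm _; rewrite -scalerAl top_degreeZ; have [s szs ->] := monomial_prod mm.
rewrite (@top_degree_homog (size s + d)); last exact: dhomogM (prod_var_homog s) hr.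
by case: eqP => [e|]; rewrite ?mulr0 // [_ * r]mulrC loc0 ?mulr0.
Qed.

Lemma top_degree_ideal p : chow_ideal p -> top_degree p = 0.
Proof.
move/asboolP=> [q [l ->]]; rewrite top_degreeD !top_degree_sum !big1 ?addr0 //.
  move=> a Ga; rewrite top_degree_sum big1 // => b Gb.
  apply: (@top_degree_mul_eq0 _ _ 1).
    rewrite /linrel rpredB ?rpred_sum // => S _; by rewrite dhomogX /= mdeg1.
  move=> s szs; rewrite -[linrel G a b]/(lrel Xv a b) localization_lrel //.
  by rewrite localization_low ?mulr0 // -szs addn1.
move=> S _; rewrite top_degree_sum big1 // => U iSU.
apply: (@top_degree_mul_eq0 _ _ 2).
  by rewrite -[2%N]/(1 + 1)%N dhomogM ?dhomogX /= ?mdeg1.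
by move=> s _; rewrite localization_incomparable.
Qed.

Definition degree_fun (z : chow G) : rat := top_degree (repr z).

Lemma degree_fun_class p : degree_fun (chow_class p) = top_degree p.
Proof.
apply/eqP; rewrite -subr_eq0 -mulN1r addrC -top_degreeP scaleN1r addrC.
rewrite top_degree_ideal // -chow_class_eq0 rmorphB /= chow_reprK.
by rewrite subrr.
Qed.

Lemma degree_funD z w : degree_fun (z + w) = degree_fun z + degree_fun w.
Proof.
by rewrite -[z]chow_reprK -[w]chow_reprK -rmorphD !degree_fun_class top_degreeD.
Qed.

Lemma degree_funZ c z : degree_fun (chow_scalar G c * z) = c * degree_fun z.
Proof.
by rewrite -[z]chow_reprK /chow_scalar -rmorphM !degree_fun_class mul_mpolyC top_degreeZ.
Qed.

Lemma degree_fun0 : degree_fun 0 = 0.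
Proof. by rewrite -(rmorph0 (@chow_class T G)) degree_fun_class top_degree0. Qed.

Lemma degree_fun_flag s : flag s -> size s = m -> degree_fun (\prod_(S <- s) x_ S) = 1.
Proof.
move=> fs szs; rewrite -rmorph_prod degree_fun_class.
rewrite (top_degree_homog (prod_var_homog s)) szs eqxx.
exact: localization_flag.
Qed.

(** * The top degree is one-dimensional *)

Section Alpha.
Variable g0 : T.
Hypothesis Gg0 : g0 \in G.

(** The hyperplane class pulled back from projective space. *)
Definition alpha : chow G := \sum_(S : psub G | g0 \in val S) x_ S.

Lemma alphaE g : g \in G -> alpha = \sum_(S : psub G | g \in val S) x_ S.
Proof. by move=> Gg; apply/eqP; rewrite -subr_eq0; apply/eqP/x_lrel. Qed.

(** With one factor [alpha] based at [g] outside [S], a set containing [g] and comparable with [S]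
    lies strictly above [S]; each factor thus moves up. *)
Lemma x_alpha_expand S g j : g \in G -> g \notin val S ->
  x_ S * alpha ^+ j.+1 =
  \sum_(U : psub G | (g \in val U) && (val S \proper val U)) x_ S * (x_ U * alpha ^+ j).
Proof.
move=> Gg nSg; rewrite exprS {1}(alphaE Gg) mulr_suml mulr_sumr.
rewrite (bigID (fun U : psub G => val S \proper val U)) /= [X in _ + X]big1 ?addr0 //.
move=> U /andP[Ug nSU]; rewrite mulrA x_incomparable ?mul0r //.
apply/andP; split; last by apply: contra nSg => /subsetP->.
apply: contra nSU => sSU; rewrite properEneq sSU andbT.
by apply: contraNneq nSg => /val_inj->.
Qed.

Lemma psub_compl S : exists2 g, g \in G & g \notin val S.
Proof. by have /andP[_ /properP[_ [g]]] := valP S; exists g. Qed.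

Lemma x_alpha_eq0 S j : (m < #|val S| + j)%N -> x_ S * alpha ^+ j = 0.
Proof.
elim: j S => [|j IHj] S lt_m; first by have := psub_card_lt S; lia.
have [g Gg nSg] := psub_compl S.
rewrite (x_alpha_expand _ Gg nSg) big1 // => U /andP[_ /proper_card ltSU].
by rewrite IHj ?mulr0 //; lia.
Qed.

Lemma x_alpha_step S U j : val S \proper val U -> #|val U| = #|val S|.+1 ->
  (#|val U| + j)%N = m -> x_ S * alpha ^+ j.+1 = x_ S * (x_ U * alpha ^+ j).
Proof.
move=> pSU cU eq_m; have [sSU [g Ug nSg]] := properP pSU.
rewrite (x_alpha_expand _ (subsetP (psub_sub U) _ Ug) nSg).
rewrite (bigD1 U) ?Ug ?pSU //= big1 ?addr0 // => V /andP[/andP[Vg pSV] neVU].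
rewrite x_alpha_eq0 ?mulr0 // -eq_m ltn_add2r ltn_neqAle cU proper_card // andbT.
apply: contra neVU => /eqP cV; rewrite -val_eqE /= eq_sym eqEcard -cV cU leqnn andbT.
have -> : val U = g |: val S.
  apply/esym/eqP; rewrite eqEcard subUset sub1set Ug sSU cU cardsU1 nSg add1n leqnn.
  by [].
by rewrite subUset sub1set Vg proper_sub.
Qed.

Lemma chain_alpha S s : chain (S :: s) ->
  map (fun U : psub G => #|val U|) s = iota #|val S|.+1 (size s) ->
  (#|val S| + size s)%N = m -> x_ S * \prod_(U <- s) x_ U = x_ S * alpha ^+ size s.
Proof.
elim: s S => [|U s IHs] S; first by rewrite big_nil.
move=> /= /andP[pSU cs] [cU crd] eq_m.
rewrite big_cons IHs ?cU //; last by rewrite -eq_m; lia.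
by rewrite (x_alpha_step pSU) // cU -eq_m; lia.
Qed.

(* Every complete flag has the same product [alpha ^+ m]: by [x_alpha_eq0], only
   the one-element enlargement of [S] survives in [x_ S * alpha ^+ (m - #|S|)]. *)
Lemma complete_flag_alpha s : flag s -> size s = m -> \prod_(S <- s) x_ S = alpha ^+ m.
Proof.
move=> /flag_chain[s' ps cs] szs; rewrite (perm_big _ ps) /=.
rewrite (perm_size ps) in szs; have := complete_chain_cards cs szs.
case: s' {ps} cs szs => [|S s'] cs szs; first by rewrite -szs big_nil.
rewrite -szs /= => -[cS crd]; rewrite big_cons chain_alpha ?cS //.
(* The chain starts at a singleton. With one factor [alpha] based at its element, every other set
   has size at least 2 and dies against [alpha ^+ (m - 1)]. *)
have /cards1P[g Sg] : #|val S| == 1%N by rewrite cS.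
have Gg : g \in G by rewrite (subsetP (psub_sub S)) // Sg set11.
rewrite exprS {2}(alphaE Gg) mulr_suml (bigD1 S) ?Sg ?set11 //= big1 ?addr0 //.
move=> U /andP[Ug neUS]; apply: x_alpha_eq0.
suff: (#|val S| < #|val U|)%N by rewrite cS -szs /=; lia.
by rewrite proper_card // properEneq eq_sym (inj_eq val_inj) neUS Sg sub1set.
Qed.

(** Straightening leaves complete flags only, all equal to [alpha ^+ m]. This gives the injectivity
    required of a degree map. *)
Lemma chow_top z : chow_deg m z -> z = chow_scalar G (degree_fun z) * alpha ^+ m.
Proof.
pose P z := z = chow_scalar G (degree_fun z) * alpha ^+ m.
have P0 : P 0 by rewrite /P degree_fun0 rmorph0 mul0r.
have PZ c w : P w -> P (chow_scalar G c * w).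
  by rewrite /P degree_funZ rmorphM -mulrA => <-.
have PD w w' : P w -> P w' -> P (w + w').
  by rewrite /P degree_funD rmorphD mulrDl => <- <-.
case=> p hp ->; apply: (@homog_span (fun p => P (chow_class p)) _ _ _ _ _ _ hp).
- by rewrite rmorph0.
- by move=> q r Pq Pr; rewrite rmorphD; apply: PD.
- by move=> c q Pq; rewrite -mul_mpolyC rmorphM; apply: PZ.
move=> s szs; rewrite rmorph_prod /=.
apply: (@straighten _ _ _ (@x_ T G) P m) => //.
- move=> w w' Pw Pw'; apply: PD => //.
  by rewrite -mulN1r -(rmorph1 (chow_scalar G)) -rmorphN; apply: PZ.
- by move=> S U s' iSU _; rewrite x_incomparable // mul0r.
- by move=> a b s' Ga Gb _; rewrite x_lrel // mul0r.
move=> s' fs' szs'.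
by rewrite /P degree_fun_flag // rmorph1 mul1r complete_flag_alpha.
Qed.

End Alpha.

Lemma degree_map_exists : G != set0 -> is_degree_map degree_fun.
Proof.
case/set0Pn=> g Gg; split.
- by move=> c z w; rewrite degree_funD degree_funZ.
- move=> d z ne [p hp ->]; rewrite degree_fun_class (top_degree_homog hp).
  by rewrite (negbTE ne).
- by move=> z w hz hw e; rewrite (chow_top Gg hz) (chow_top Gg hw) e.
- by move=> s /chain_flag; apply: degree_fun_flag.
Qed.

Lemma chow_integralP : G != set0 -> is_degree_map (@integral T G).
Proof. by move=> /degree_map_exists; apply: classical_sets.xgetI. Qed.

End DegreeMap.

(** * Ranks, flats and closures *)

Section MatroidBasics.
Variables (T : finType) (G : {set T}) (N : matroid G).
Local Open Scope nat_scope.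
Implicit Types (A B F : {set T}).

Lemma rk_set0 : rk N set0 = 0.
Proof. by apply/eqP; rewrite -leqn0 -(cards0 T) rk_card ?sub0set. Qed.

Lemma rk_setU_le A B : A \subset G -> B \subset G ->
  rk N (A :|: B) <= rk N A + #|B|.
Proof.
move=> sA sB; apply: leq_trans (leq_trans (rk_submod N sA sB) _).
  exact: leq_addr.
by rewrite leq_add2l rk_card.
Qed.

Lemma rk_setU1_le x A : A \subset G -> x \in G -> rk N (x |: A) <= (rk N A).+1.
Proof.
move=> sA Gx; rewrite setUC -addn1 -(cards1 x).
by apply: rk_setU_le; rewrite ?sub1set.
Qed.

(** Monotonicity of the nullity, written without subtraction. *)
Lemma rk_card_mono A B : A \subset B -> B \subset G ->
  rk N B + #|A| <= rk N A + #|B|.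
Proof.
move=> sAB sBG; have := rk_setU_le (subset_trans sAB sBG) (subset_trans (subsetDl B A) sBG).
have -> : A :|: B :\: A = B by rewrite -{1}(setIidPr sAB) setID.
rewrite cardsDS //.
by have := subset_leq_card sAB; lia.
Qed.

Lemma flatP F : reflect (F \subset G /\
  forall x, x \in G -> x \notin F -> rk N F < rk N (x |: F)) (flat N F).
Proof.
apply: (iffP andP) => -[sF hF]; split=> //.
  by move=> x Gx nFx; apply: (implyP (forallP hF x)); rewrite inE nFx.
by apply/forallP => x; apply/implyP; rewrite inE => /andP[nFx Gx]; apply: hF.
Qed.

Lemma flat_rk_lt F B : flat N F -> F \proper B -> B \subset G -> rk N F < rk N B.
Proof.
case/flatP=> sF hF /properP[sFB [x Bx nFx]] sB.
apply: leq_trans (hF x (subsetP sB _ Bx) nFx) _; apply: rk_mono => //.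
by rewrite subUset sub1set Bx.
Qed.

Lemma flat_rk_eq F B : flat N F -> F \subset B -> B \subset G -> rk N B <= rk N F ->
  F = B.
Proof.
move=> fF sFB sB le_rk; apply/eqP; apply: contraTT le_rk => ne.
by rewrite -ltnNge flat_rk_lt // properEneq ne.
Qed.

Lemma loopless_rk_gt0 A : loopless N -> A != set0 -> A \subset G -> 0 < rk N A.
Proof.
move=> /forallP hN /set0Pn[x Ax] sA; have Gx := subsetP sA _ Ax.
have := hN x; rewrite Gx /= -lt0n => /leq_trans; apply.
by apply: rk_mono; rewrite ?sub1set.
Qed.

(** Lets the descriptions of the flats of a minor also decide its looplessness. *)
Lemma loopless_flat0 : loopless N = flat N set0.
Proof.
rewrite /flat sub0set setD0 rk_set0; apply: eq_forallb => x.
by rewrite setU0 lt0n.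
Qed.

Definition mclosure A := [set x in G | rk N (x |: A) == rk N A].

Lemma mclosure_subG A : mclosure A \subset G.
Proof. by apply/subsetP => x; rewrite inE => /andP[]. Qed.

Lemma sub_mclosure A : A \subset G -> A \subset mclosure A.
Proof.
move=> sA; apply/subsetP => x Ax; rewrite inE (subsetP sA) //=.
by rewrite (setUidPr _) ?sub1set.
Qed.

Lemma rk_setU_closure A B : A \subset G -> B \subset mclosure A ->
  rk N (A :|: B) = rk N A.
Proof.
move=> sA; have [k] := ubnP #|B|; elim: k B => // k IHk B.
rewrite ltnS => le_k sB; have [->|/set0Pn[x Bx]] := eqVneq B set0.
  by rewrite setU0.
have IH : rk N (A :|: B :\ x) = rk N A.
  apply: IHk; last exact: subset_trans (subsetDl _ _) sB.
  by move: le_k; rewrite (cardsD1 x B) Bx.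
have := subsetP sB _ Bx; rewrite inE => /andP[Gx /eqP rx].
have sBG := subset_trans sB (mclosure_subG A).
have sU : A :|: B :\ x \subset G.
  by rewrite subUset sA (subset_trans (subsetDl _ _) sBG).
have sxA : x |: A \subset G by rewrite subUset sub1set Gx.
have := rk_submod N sU sxA.
have -> : A :|: B :\ x :|: (x |: A) = A :|: B.
  by apply/setP => y; rewrite !inE; case: eqVneq => [->|_]; rewrite ?Bx ?orbT //= orbAC orbb.
have sAI : A \subset (A :|: B :\ x) :&: (x |: A) by rewrite subsetI subsetUl subsetUr.
have := rk_mono N sAI (subset_trans (subsetIl _ _) sU).
have := rk_mono N (subsetUl A B); rewrite subUset sA sBG => /(_ isT).
by rewrite IH rx; lia.
Qed.

Lemma rk_mclosure A : A \subset G -> rk N (mclosure A) = rk N A.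
Proof.
move=> sA; rewrite -{1}(setUidPr (sub_mclosure sA)).
exact: rk_setU_closure.
Qed.

Lemma mclosure_flat A : A \subset G -> flat N (mclosure A).
Proof.
move=> sA; apply/flatP; split; first exact: mclosure_subG.
move=> x Gx; apply: contraR; rewrite -leqNgt rk_mclosure // => le_rk.
have sxA : x |: A \subset G by rewrite subUset sub1set Gx.
rewrite inE Gx eqn_leq (rk_mono N (subsetUr [set x] A)) // andbT.
apply: leq_trans le_rk; apply: rk_mono; first exact: setUS (sub_mclosure sA).
by rewrite subUset sub1set Gx mclosure_subG.
Qed.

Lemma mclosure_min A F : flat N F -> A \subset F -> mclosure A \subset F.
Proof.
move=> /flatP[sF hF] sAF; apply/subsetP => x; rewrite inE => /andP[Gx /eqP rx].
apply: contraT => nFx; have := hF x Gx nFx.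
have sxA : x |: A \subset G by rewrite subUset sub1set Gx (subset_trans sAF).
have := rk_submod N sxA sF.
have -> : x |: A :|: F = x |: F by rewrite -setUA (setUidPr sAF).
have sAI : A \subset (x |: A) :&: F by rewrite subsetI subsetUr.
by have := rk_mono N sAI (subset_trans (subsetIr _ _) sF); lia.
Qed.

End MatroidBasics.

(** * Linearity of the degree map *)

Section IntegralBasics.
Variables (T : finType) (G : {set T}).
Hypothesis G_neq0 : G != set0.
Notation deg := (@integral T G).
Implicit Types (s : seq (psub G)).

Lemma chow_integralZD c z w : deg (chow_scalar G c * z + w) = c * deg z + deg w.
Proof. exact: degree_linear (chow_integralP G_neq0) c z w. Qed.

Lemma chow_integral0 : deg 0 = 0.
Proof. by have := chow_integralZD 1 0 0; rewrite mulr0 addr0; lra. Qed.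

Lemma chow_integralD z w : deg (z + w) = deg z + deg w.
Proof. by rewrite -[z]mul1r -(rmorph1 (chow_scalar G)) chow_integralZD rmorph1 !mul1r. Qed.

Lemma chow_integralZ c z : deg (chow_scalar G c * z) = c * deg z.
Proof. by rewrite -[_ * z]addr0 chow_integralZD chow_integral0 addr0. Qed.

Lemma chow_integral_sum (I : finType) (P : pred I) (F : I -> chow G) :
  deg (\sum_(i | P i) F i) = \sum_(i | P i) deg (F i).
Proof. exact: (big_morph _ chow_integralD chow_integral0). Qed.

Lemma chow_integral_flag s : flag s -> size s = #|G|.-1 -> deg (\prod_(S <- s) x_ S) = 1.
Proof.
move=> /flag_chain[s' ps cs] szs; rewrite (perm_big _ ps) /=.
by apply: degree_flag (chow_integralP G_neq0) _ cs _; rewrite -(perm_size ps).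
Qed.

End IntegralBasics.

(** * Elementary quotients and the Bergman class *)

Section FlagFlats.
Variables (T : finType) (G : {set T}) (N : matroid G).
Implicit Types (S U : psub G) (s : seq (psub G)).

Lemma flag_rk_uniq s : flag s -> all (fun S => flat N (val S)) s ->
  uniq (map (fun S : psub G => rk N (val S)) s).
Proof.
case/andP=> us /all_nestedP cs /allP fs; rewrite map_inj_in_uniq // => S U sS sU e.
apply: val_inj; have := cs S U sS sU; rewrite nestedE => /orP[sSU|sUS].
  by apply: flat_rk_eq (fs _ sS) sSU (psub_sub U) _; rewrite e.
by apply/esym/(flat_rk_eq (fs _ sU) sUS (psub_sub S) _); rewrite e.
Qed.

Lemma flag_flats_size s : loopless N -> flag s -> all (fun S => flat N (val S)) s ->
  (size s <= (mrank N).-1)%N.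
Proof.
move=> lN fs afs; have := flag_rk_uniq fs afs.
rewrite -(size_map (fun S : psub G => rk N (val S))) -(size_iota 1 (mrank N).-1).
move/uniq_leq_size; apply=> r /mapP[S sS ->]; rewrite mem_iota.
rewrite loopless_rk_gt0 ?psub_neq0 ?psub_sub // andTb.
have : (rk N (val S) < rk N G)%N.
  apply: flat_rk_lt (allP afs _ sS) _ (subxx _).
  by rewrite properEneq psub_neqG psub_sub.
move=> lt_S; rewrite add1n prednK //; exact: leq_ltn_trans lt_S.
Qed.

End FlagFlats.

Section ElementaryQuotient.
Variables (T : finType) (G : {set T}) (N N' : matroid G).
Implicit Types (A B F : {set T}) (S U : psub G) (s : seq (psub G)).

Hypothesis rk_le : forall A, A \subset G -> (rk N' A <= rk N A <= (rk N' A).+1)%N.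
Hypothesis rk_diff_mono : forall A B, A \subset B -> B \subset G ->
  (rk N A + rk N' B <= rk N B + rk N' A)%N.
Hypothesis loopless_N' : loopless N'.

(** The flats of [N] with this property form the modular cut of the elementary quotient [N']. *)
Definition dropped A := (rk N' A < rk N A)%N.

Lemma dropped_mono A B : A \subset B -> B \subset G -> dropped A -> dropped B.
Proof. by rewrite /dropped => sAB sB; move: (rk_diff_mono sAB sB); slia. Qed.

Lemma droppedE A : A \subset G -> rk N A = (rk N' A + dropped A)%N.
Proof. by rewrite /dropped => /rk_le; case: ltnP => /=; slia. Qed.

Lemma quotient_flat F : flat N' F -> flat N F.
Proof.
case/flatP=> sF hF; apply/flatP; split=> // x Gx nFx; have := hF x Gx nFx.
have := rk_diff_mono (subsetUr [set x] F); rewrite subUset sub1set Gx sF => /(_ isT).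
slia.
Qed.

Lemma loopless_N : loopless N.
Proof. by rewrite loopless_flat0 quotient_flat // -loopless_flat0. Qed.

Variable s : seq (psub G).
Hypothesis flag_s : flag s.
Hypothesis size_s : (size s).+2 = rk N G.
Hypothesis flats_s : all (fun S => flat N (val S)) s.
Variables A B : {set T}.
Hypothesis A_in : A = set0 \/ exists2 S, S \in s & A = val S.
Hypothesis B_in : B = G \/ exists2 S, S \in s & B = val S.
Hypothesis dropA : ~~ dropped A.
Hypothesis dropB : dropped B.
Hypothesis pAB : A \proper B.
Hypothesis s_split : {in s, forall S,
  if dropped (val S) then B \subset val S else val S \subset A}.

Let sB : B \subset G.
Proof. by case: B_in => [->|[S _ ->]]; rewrite ?psub_sub. Qed.

Let sAB : A \subset B := proper_sub pAB.
Let sA : A \subset G := subset_trans sAB sB.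

Let flatA : flat N A.
Proof.
case: A_in => [->|[S sS ->]]; last exact: (allP flats_s).
by rewrite -loopless_flat0 loopless_N.
Qed.

Let rkA : rk N' A = rk N A.
Proof. by rewrite (droppedE sA) (negbTE dropA) addn0. Qed.

Let rkB : rk N B = (rk N' B).+1.
Proof. by rewrite (droppedE sB) dropB addn1. Qed.

Let rkAB : (rk N A < rk N B)%N.
Proof. exact: flat_rk_lt pAB sB. Qed.

(* The [#|s|] ranks of the flats in [s] avoid the gap between [A] and [B]. *)
Lemma rk_gap : (rk N B <= (rk N A).+2)%N.
Proof.
have rkBG : (rk N B <= rk N G)%N by apply: rk_mono.
pose l := iota 1 (rk N A) ++ iota (rk N B) (rk N G - rk N B).
have := flag_rk_uniq flag_s flats_s.
move/(@uniq_leq_size _ _ l); rewrite size_map size_cat !size_iota => le_s.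
suff /le_s : {subset map (fun S : psub G => rk N (val S)) s <= l}.
  by move: size_s rkAB rkBG; slia.
move=> _ /mapP[S sS ->]; rewrite mem_cat !mem_iota.
have := loopless_rk_gt0 loopless_N (psub_neq0 S) (psub_sub S).
have : (rk N (val S) < rk N G)%N.
  apply: flat_rk_lt (allP flats_s _ sS) _ (subxx _).
  by rewrite properEneq psub_neqG psub_sub.
have := s_split sS; case: ifP => _ sub.
  by move: (rk_mono N sub (psub_sub S)) rkBG; slia.
by move: (rk_mono N sub sA) rkBG; slia.
Qed.

Let not_flats (Q : {set T}) : A \proper Q -> Q \subset G -> rk N' Q = rk N' A ->
  ~~ all (fun S => flat N' (val S)) s.
Proof.
move=> pAQ sQ eQ; case: A_in => [A0|[S sS AS]].
  have Q0 : Q != set0 by apply: contraTneq pAQ => ->; rewrite A0 properxx.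
  by have := loopless_rk_gt0 loopless_N' Q0 sQ; rewrite eQ A0 rk_set0 ltnn.
apply/allPn; exists S => //; rewrite -AS; apply/negP => fA.
by have := flat_rk_lt fA pAQ sQ; rewrite eQ ltnn.
Qed.

Definition gap_flat S := [&& flat N (val S), A \proper val S & val S \proper B].

Lemma gap_flat_rk S : gap_flat S -> rk N (val S) = (rk N A).+1 /\ rk N B = (rk N A).+2.
Proof.
case/and3P=> fS pAS pSB; have := rk_gap.
have := flat_rk_lt flatA pAS (psub_sub S); have := flat_rk_lt fS pSB sB; slia.
Qed.

(** Both have rank one above [A], and so has their intersection, which contains [e |: A]; by
    submodularity the union has that rank too, and a flat equals any larger set of its rank. *)
Lemma gap_flat_eq S U e : gap_flat S -> gap_flat U ->
  e \in val S -> e \in val U -> e \notin A -> S = U.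
Proof.
move=> gS gU Se Ue nAe; apply: val_inj.
have [[rS _] [rU _]] := (gap_flat_rk gS, gap_flat_rk gU).
case/and3P: gS gU => fS pAS _ /and3P[fU pAU _].
have sSU : val S :&: val U \subset G by rewrite subIset ?psub_sub.
have seI : e |: A \subset val S :&: val U.
  by rewrite subUset sub1set inE Se Ue subsetI !proper_sub.
have rI := rk_mono N seI sSU.
have re : (rk N A < rk N (e |: A))%N.
  have /flatP[_ ->] := flatA => //; exact: (subsetP (psub_sub S)).
have sSUU : val S :|: val U \subset G by rewrite subUset !psub_sub.
have sm := rk_submod N (psub_sub S) (psub_sub U).
have -> : val S = val S :|: val U.
  by apply: (flat_rk_eq fS (subsetUl _ _) sSUU); move: sm rI re rS rU; slia.
by apply/esym/(flat_rk_eq fU (subsetUr _ _) sSUU); move: sm rI re rS rU; slia.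
Qed.

(** In [N'] both sets have the rank of [A], hence so has their union, whose [N]-rank is then at most
    one above [A]. *)
Lemma gap_flat_dropped_eq S U : gap_flat S -> gap_flat U ->
  dropped (val S) -> dropped (val U) -> S = U.
Proof.
move=> gS gU dS dU; apply: val_inj.
have [[rS _] [rU _]] := (gap_flat_rk gS, gap_flat_rk gU).
case/and3P: gS gU => fS pAS _ /and3P[fU pAU _].
have sSU : val S :&: val U \subset G by rewrite subIset ?psub_sub.
have sAI : A \subset val S :&: val U by rewrite subsetI !proper_sub.
have rI := rk_mono N' sAI sSU.
have sSUU : val S :|: val U \subset G by rewrite subUset !psub_sub.
have sm := rk_submod N' (psub_sub S) (psub_sub U).
have := droppedE (psub_sub S); rewrite dS => eS.
have := droppedE (psub_sub U); rewrite dU => eU.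
have /andP[_ rk1] := rk_le sSUU.
have -> : val S = val S :|: val U.
  by apply: (flat_rk_eq fS (subsetUl _ _) sSUU); move: sm rI rS rU eS eU rk1 rkA; slia.
by apply/esym/(flat_rk_eq fU (subsetUr _ _) sSUU); move: sm rI rS rU eS eU rk1 rkA; slia.
Qed.

Lemma gap_closure e : e \in B -> e \notin A -> rk N B = (rk N A).+2 ->
  exists S : psub G, [/\ gap_flat S, val S = mclosure N (e |: A) & e \in val S].
Proof.
move=> Be nAe rB; have Ge := subsetP sB _ Be.
have sC : e |: A \subset G by rewrite subUset sub1set Ge.
have Ce : e \in mclosure N (e |: A) by apply: (subsetP (sub_mclosure N sC)); rewrite setU11.
have flatB : B = G \/ flat N B.
  by case: B_in => [|[S sS ->]]; [left|right; apply: (allP flats_s)].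
have sCB : mclosure N (e |: A) \subset B.
  case: flatB => [->|fB]; first exact: mclosure_subG.
  by apply: mclosure_min fB _; rewrite subUset sub1set Be.
have neCB : mclosure N (e |: A) != B.
  apply: contra_eqN rB => /eqP <-; rewrite rk_mclosure //.
  by move: (rk_setU1_le N sA Ge); slia.
have pS : (mclosure N (e |: A) != set0) && (mclosure N (e |: A) \proper G).
  apply/andP; split; first by apply/set0Pn; exists e.
  by apply: proper_sub_trans sB; rewrite properEneq neCB.
exists (exist (fun S : {set T} => (S != set0) && (S \proper G)) _ pS); split=> //.
apply/and3P; split=> /=; [exact: mclosure_flat | | by rewrite properEneq neCB].
apply/properP; split; last by exists e.
exact: subset_trans (subsetUr _ _) (sub_mclosure N sC).
Qed.

(** Suppose [x] raises the [N]-rank of a member [S] but not its [N']-rank. Then [x |: S] is dropped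
    and [S] is not, so [S] lies in [A] and [x |: A] is dropped. For [x] in [B], the closure of
    [x |: A] would be a dropped gap flat. *)
Lemma quotient_flats : (forall S : psub G, gap_flat S -> ~~ dropped (val S)) ->
  rk N B = (rk N A).+2 -> all (fun S => flat N' (val S)) s.
Proof.
move=> no_drop rB; apply/allP => S sS; have /flatP[sF hF] := allP flats_s S sS.
apply/flatP; split=> // x Gx nSx; rewrite ltnNge; apply/negP => le_rk.
have sxS : x |: val S \subset G by rewrite subUset sub1set Gx.
have dxS : dropped (x |: val S).
  by rewrite /dropped; move: (hF x Gx nSx) (rk_le sF) le_rk; slia.
have ndS : ~~ dropped (val S).
  by rewrite /dropped; move: (hF x Gx nSx) (rk_le sxS) le_rk; slia.
have := s_split sS; rewrite (negbTE ndS) => sSA.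
have sxA : x |: A \subset G by rewrite subUset sub1set Gx.
have dxA : dropped (x |: A) by apply: dropped_mono dxS; rewrite ?setUS.
have nAx : x \notin A.
  apply: contra dropA => Ax; apply: dropped_mono dxS; rewrite // subUset sub1set Ax.
  by [].
have [Bx|nBx] := boolP (x \in B).
  have [U [gU eU _]] := gap_closure Bx nAx rB.
  case/negP: (no_drop U gU); rewrite eU; apply: dropped_mono dxA.
    exact: sub_mclosure.
  exact: mclosure_subG.
(* For [x] outside [B], submodularity of [N'] on [x |: A] and [B] shows that [x] does not raise the
   [N']-rank of [B]. As [B] is dropped already, its [N]-rank does not rise either, although [B] is a
   flat of [N]. *)
have [BG|[U sU BU]] := B_in; first by rewrite BG Gx in nBx.
have /flatP[_ hB] := allP flats_s U sU; rewrite -BU in hB.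
have sxB : x |: B \subset G by rewrite subUset sub1set Gx.
have rxB := hB x Gx nBx; have /andP[_ rxB'] := rk_le sxB.
have := rk_setU1_le N sA Gx; rewrite (droppedE sxA) dxA => rxA.
have sm := rk_submod N' sxA sB.
have eU : x |: A :|: B = x |: B by rewrite -setUA (setUidPr sAB).
have sAI : A \subset (x |: A) :&: B by rewrite subsetI subsetUr.
have rI := rk_mono N' sAI (subset_trans (subsetIr _ _) sB).
rewrite eU in sm; move: sm rI rxA rxB rxB' rkA rkB; slia.
Qed.

(** If a gap flat [S0] is dropped, it is the only one; for [e] in [S0] it is also the only one
    containing [e], and its two terms cancel, while the [N']-rank of [S0] equals that of [A]. If
    none is dropped and the gap has rank 2, exactly one gap flat contains [e]. In a gap of rank 1
    there is no gap flat, and [B] has the [N']-rank of [A]. *)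
Lemma gap_sum : exists2 e, e \in B & e \notin A /\
  \sum_(S : psub G | gap_flat S) ((e \in val S)%:R - (dropped (val S))%:R) =
  (all (fun S => flat N' (val S)) s)%:R :> rat.
Proof.
have [_ [e0 Be0 nAe0]] := properP pAB.
have [/existsP[S0 /andP[g0 d0]]|/existsPn no_drop] :=
  boolP [exists S : psub G, gap_flat S && dropped (val S)].
  have [rS0 rB] := gap_flat_rk g0; have /and3P[f0 pA0 p0B] := g0.
  have [_ [e Se nAe]] := properP pA0; exists e; first exact: (subsetP (proper_sub p0B)).
  split=> //; rewrite (negbTE (not_flats pA0 (psub_sub S0) _)); last first.
    by move: (droppedE (psub_sub S0)) rkA; rewrite d0; move: rS0; slia.
  rewrite big1 // => S gS; have [->|neS] := eqVneq S S0; first by rewrite Se d0 subrr.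
  have -> : (e \in val S) = false.
    by apply: contraNF neS => eS; apply/eqP/(gap_flat_eq gS g0 eS Se nAe).
  have -> : dropped (val S) = false; last by rewrite subrr.
  by apply: contraNF neS => dS; apply/eqP/gap_flat_dropped_eq.
have no_drop' S : gap_flat S -> ~~ dropped (val S).
  by move=> gS; have := no_drop S; rewrite gS.
exists e0 => //; split=> //; have := rk_gap; rewrite leq_eqVlt => /orP[/eqP rB|lt_rB].
  rewrite quotient_flats //; have [S1 [g1 eS1 Se1]] := gap_closure Be0 nAe0 rB.
  rewrite (bigD1 S1) //= Se1 (negbTE (no_drop' _ g1)) subr0 big1 ?addr0 //.
  move=> S /andP[gS neS]; rewrite (negbTE (no_drop' _ gS)) subr0.
  have -> // : (e0 \in val S) = false.
  by apply: contraNF neS => eS; apply/eqP/(gap_flat_eq gS g1 eS Se1 nAe0).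
rewrite big_pred0 => [|S]; last first.
  by apply/negP => /gap_flat_rk[_ rB]; move: lt_rB; rewrite rB ltnn.
by rewrite (negbTE (not_flats pAB sB _)) //; move: rkA rkB rkAB lt_rB; slia.
Qed.

End ElementaryQuotient.

Section FlagForm.
Variables (T : finType) (G : {set T}).

(** The numerical half of [is_bergman_class], over unordered flags; the degree is counted
    separately. *)
Definition bergman_on_flags (N : matroid G) (z : chow G) :=
  forall s : seq (psub G), flag s -> size s = (mrank N).-1 ->
    integral (z * \prod_(S <- s) x_ S) = (all (fun S : psub G => flat N (val S)) s)%:R.

Definition divisor (f : {set T} -> rat) : chow G :=
  \sum_(S : psub G) chow_scalar G (f (val S)) * x_ S.

Lemma divisor_shift (f : {set T} -> rat) (a b : T) : a \in G -> b \in G ->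
  divisor (fun A => (a \in A)%:R - f A) = divisor (fun A => (b \in A)%:R - f A).
Proof.
move=> Ga Gb; apply/eqP; rewrite -subr_eq0 -sumrB; apply/eqP.
rewrite -[RHS](x_lrel Ga Gb) lrelE; apply: eq_bigr => S _.
rewrite -mulrBl -rmorphB opprB addrA subrK rmorphB !rmorph_nat; congr (_ * _).
Qed.

End FlagForm.

Section Step.
Variables (T : finType) (G : {set T}) (N N' : matroid G).
Implicit Types (A B F : {set T}) (S U : psub G) (s : seq (psub G)).

Hypothesis G_neq0 : G != set0.
Hypothesis rk_le : forall A, A \subset G -> (rk N' A <= rk N A <= (rk N' A).+1)%N.
Hypothesis rk_diff_mono : forall A B, A \subset B -> B \subset G ->
  (rk N A + rk N' B <= rk N B + rk N' A)%N.
Hypothesis rk_top : rk N G = (rk N' G).+1.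
Hypothesis loopless_N' : loopless N'.

(** As [f] vanishes on [s], no factor gets repeated. A set incomparable with a member contributes 0,
    and the others lengthen [s] to a flag on which [z] is known. *)
Lemma integral_divisor_flag z (f : {set T} -> rat) s :
  bergman_on_flags N z -> flag s -> (size s).+1 = (mrank N).-1 ->
  {in s, forall S, f (val S) = 0} ->
  integral (z * divisor G f * \prod_(S <- s) x_ S) =
  \sum_(S : psub G | flag (S :: s))
     f (val S) * (all (fun U => flat N (val U)) (S :: s))%:R.
Proof.
move=> zN fs szs f0; rewrite mulr_sumr mulr_suml chow_integral_sum // [RHS]big_mkcond.
apply: eq_bigr => S _; rewrite mulrCA -!mulrA chow_integralZ //.
case: ifP => [fS|/negP/negP nfS].
  by rewrite -zN // big_cons.
have [sS|nS] := boolP (S \in s); first by rewrite f0 // mul0r.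
have /allPn[U sU] : ~~ all (nested S) s.
  by apply: contra nfS => /allP cS; apply/flag_consP.
rewrite negbK => iSU; rewrite (big_rem U) //= [x_ S * _]mulrA x_incomparable //.
by rewrite mul0r mulr0 chow_integral0 // mulr0.
Qed.

(** Between the largest member [A] that is not dropped and the smallest dropped one [B], pick [e].
    Rebased at [e], the divisor has coefficient [1 - 1] on members containing [B] and [0 - 0] on
    members inside [A]; [gap_sum] chooses [e] and evaluates what remains. *)
Lemma bergman_step z g : g \in G -> bergman_on_flags N z ->
  bergman_on_flags N' (z * divisor G (fun A => (g \in A)%:R - (dropped N N' A)%:R)).
Proof.
move=> Gg zN s fs szs; have /andP[us cs] := fs.
have [A hA leA] := clique_max (clique_filter (fun S => ~~ dropped N N' (val S)) cs).
have [B hB leB] := clique_min (clique_filter (fun S => dropped N N' (val S)) cs).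
have dmono := @dropped_mono _ _ _ _ rk_diff_mono.
have A_in : A = set0 \/ exists2 S, S \in s & A = val S.
  case: hA => [|[S + ->]]; [by left|rewrite mem_filter => /andP[_ sS]].
  by right; exists S.
have B_in : B = G \/ exists2 S, S \in s & B = val S.
  case: hB => [|[S + ->]]; [by left|rewrite mem_filter => /andP[_ sS]].
  by right; exists S.
have dropA : ~~ dropped N N' A.
  case: hA => [->|[S + ->]]; first by rewrite /dropped !rk_set0.
  by rewrite mem_filter => /andP[].
have dropB : dropped N N' B.
  case: hB => [->|[S + ->]]; first by rewrite /dropped rk_top.
  by rewrite mem_filter => /andP[].
have sB : B \subset G by case: B_in => [->|[S _ ->]]; rewrite ?psub_sub.
have sA : A \subset G by case: A_in => [->|[S _ ->]]; rewrite ?psub_sub ?sub0set.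
have sAB : A \subset B.
  case: A_in (A_in) => [-> _|[S sS AS] _]; first exact: sub0set.
  case: B_in (B_in) => [-> _|[U sU BU] _] //.
  have := all_nestedP _ cs S U sS sU; rewrite nestedE -AS -BU => /orP[] // sBA.
  by case/negP: dropA; apply: dmono dropB.
have pAB : A \proper B.
  by rewrite properEneq sAB andbT; apply: contraNneq dropA => ->.
have s_split : {in s, forall S, if dropped N N' (val S) then B \subset val S else val S \subset A}.
  move=> S sS; case: ifPn => dS; first by apply: leB; rewrite mem_filter dS.
  by apply: leA; rewrite mem_filter dS.
have f0 e : e \in B -> e \notin A ->
    {in s, forall S, (e \in val S)%:R - (dropped N N' (val S))%:R = 0 :> rat}.
  move=> Be nAe S sS; have := s_split S sS; case: ifP => _ /subsetP sub.
    by rewrite sub // subrr.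
  by rewrite (contraNF (sub e) nAe) subrr.
have lN : loopless N by apply: loopless_N rk_diff_mono loopless_N'.
have rkN' : (0 < rk N' G)%N by apply: loopless_rk_gt0.
have szs1 : (size s).+1 = (mrank N).-1 by rewrite szs /mrank rk_top /= prednK.
(* A member that is no flat of [N] is no flat of [N'], so both sides are then 0. *)
have [/= flats_s|nflats_s] := boolP (all (fun S => flat N (val S)) s); last first.
  have [_ [e Be nAe]] := properP pAB.
  rewrite (divisor_shift _ Gg (subsetP sB _ Be)).
  rewrite (integral_divisor_flag zN fs szs1 (f0 e Be nAe)) big1.
    have [/allP fN'|//] := boolP (all _ _).
    case/negP: nflats_s; apply/allP => S sS; apply: quotient_flat rk_diff_mono _ _.
    exact: fN'.
  by move=> S _; rewrite /= (negbTE nflats_s) andbF mulr0.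
have szs2 : (size s).+2 = rk N G by rewrite szs1 /mrank prednK // rk_top.
have [e Be [nAe <-]] := gap_sum rk_le rk_diff_mono loopless_N' fs szs2
  flats_s A_in B_in dropA dropB pAB s_split.
rewrite (divisor_shift _ Gg (subsetP sB _ Be)).
rewrite (integral_divisor_flag zN fs szs1 (f0 e Be nAe)).
(* Extensions by a flat inside [A] or containing [B] have coefficient 0; the remaining ones are the
   gap flats. *)
rewrite [LHS]big_mkcond [RHS]big_mkcond; apply: eq_bigr => S _ /=.
rewrite flats_s andbT; case: (boolP (gap_flat _ _ _ _)) => [/and3P[fS pAS pSB]|ngS].
  have -> : flag (S :: s).
    apply/flag_consP; split=> // [|U sU].
      apply/negP => sS; have := s_split S sS; case: ifP => _ sub.
        by have := proper_sub_trans pSB sub; rewrite properxx.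
      by have := sub_proper_trans sub pAS; rewrite properxx.
    rewrite nestedE; have := s_split U sU; case: ifP => _ sub.
      by rewrite (subset_trans (proper_sub pSB) sub).
    by rewrite (subset_trans sub (proper_sub pAS)) orbT.
  by rewrite fS mulr1.
case: ifP => // /flag_consP[nS cS _].
have [fS|] := boolP (flat N (val S)); last by rewrite mulr0.
rewrite mulr1.
have [sSA|nSA] := boolP (val S \subset A).
  rewrite (contraNF (subsetP sSA e) nAe).
  by rewrite (negbTE (contra (dmono _ _ sSA sA) dropA)) subrr.
have [sBS|nBS] := boolP (B \subset val S).
  by rewrite (subsetP sBS) // (dmono _ _ sBS (psub_sub S) dropB) subrr.
case/negP: ngS; apply/and3P; split=> //; rewrite properE ?nSA ?nBS andbT.
  case: A_in => [->|[U sU AU]]; first exact: sub0set.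
  by have := cS U sU; rewrite nestedE -AU (negbTE nSA).
case: B_in => [->|[U sU BU]]; first exact: psub_sub.
by have := cS U sU; rewrite nestedE -BU (negbTE nBS) orbF.
Qed.

End Step.

(** * Higgs lifts and the existence of the Bergman class *)

Section HiggsLift.
Variables (T : finType) (G : {set T}) (N : matroid G).
Local Open Scope nat_scope.

Definition higgs_rk k (A : {set T}) := minn (rk N A + k) #|A|.

Lemma higgs_rk_card k (A : {set T}) : A \subset G -> higgs_rk k A <= #|A|.
Proof. by move=> _; apply: geq_minr. Qed.

Lemma higgs_rk_mono k (A B : {set T}) :
  A \subset B -> B \subset G -> higgs_rk k A <= higgs_rk k B.
Proof.
move=> sAB sB; rewrite /higgs_rk; move: (rk_mono N sAB sB) (subset_leq_card sAB).
clear; lia.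
Qed.

(** [higgs_rk k A] is [#|A|] minus the excess of the nullity over [k]. This excess is supermodular
    because the nullity is supermodular and monotone. *)
Lemma higgs_rk_submod k (A B : {set T}) : A \subset G -> B \subset G ->
  higgs_rk k (A :|: B) + higgs_rk k (A :&: B) <= higgs_rk k A + higgs_rk k B.
Proof.
move=> sA sB; rewrite /higgs_rk.
have sU : A :|: B \subset G by rewrite subUset sA.
move: (rk_submod N sA sB) (cardsUI A B).
move: (rk_card_mono N (subsetUl A B) sU) (rk_card_mono N (subsetUr A B) sU).
move: (rk_card_mono N (subsetIl A B) sA) (rk_card_mono N (subsetIr A B) sB).
by clear; lia.
Qed.

Definition higgs k : matroid G :=
  Matroid (@higgs_rk_card k) (@higgs_rk_mono k) (@higgs_rk_submod k).

Lemma rk_higgs k (A : {set T}) : rk (higgs k) A = minn (rk N A + k) #|A|.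
Proof. by []. Qed.

Definition nullity := #|G| - mrank N.

Lemma rk_higgs0 (A : {set T}) : A \subset G -> rk (higgs 0) A = rk N A.
Proof. by move=> sA; rewrite rk_higgs addn0; apply/minn_idPl/rk_card. Qed.

Lemma rk_higgs_nullity (A : {set T}) : A \subset G -> rk (higgs nullity) A = #|A|.
Proof.
move=> sA; rewrite rk_higgs; apply/minn_idPr; rewrite /nullity /mrank.
by move: (rk_card_mono N sA (subxx G)) (rk_card N (subxx G)); clear; lia.
Qed.

Lemma flat_eq_rk (N1 N2 : matroid G) (A : {set T}) : {in powerset G, rk N1 =1 rk N2} ->
  flat N1 A = flat N2 A.
Proof.
move=> eqr; have [sA|nsA] := boolP (A \subset G); last by rewrite /flat (negbTE nsA).
by apply/flatP/flatP => -[_ hA]; split=> // x Gx nAx; have := hA x Gx nAx;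
  rewrite !eqr // inE // subUset sub1set Gx.
Qed.

Lemma loopless_higgs k : loopless N -> loopless (higgs k).
Proof.
move=> /forallP hN; apply/forallP => x; apply/implyP => Gx.
by have := hN x; rewrite Gx rk_higgs cards1 /=; clear; lia.
Qed.

Lemma higgs_rk_le k (A : {set T}) : A \subset G ->
  rk (higgs k) A <= rk (higgs k.+1) A <= (rk (higgs k) A).+1.
Proof. by move=> _; rewrite !rk_higgs; clear; lia. Qed.

Lemma higgs_rk_diff_mono k (A B : {set T}) : A \subset B -> B \subset G ->
  rk (higgs k.+1) A + rk (higgs k) B <= rk (higgs k.+1) B + rk (higgs k) A.
Proof.
move=> sAB sB; rewrite !rk_higgs; move: (rk_card_mono N sAB sB) (rk_mono N sAB sB).
by move: (subset_leq_card sAB); clear; lia.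
Qed.

Lemma higgs_rk_top k : k < nullity -> rk (higgs k.+1) G = (rk (higgs k) G).+1.
Proof. by rewrite /nullity /mrank !rk_higgs; clear; lia. Qed.

End HiggsLift.

Section BergmanExists.
Variables (T : finType) (G : {set T}) (N : matroid G).
Hypothesis G_neq0 : G != set0.
Hypothesis loopless_N : loopless N.

Lemma chow_deg_prod d (l : seq nat) (F : nat -> chow G) :
  (forall i, chow_deg d (F i)) -> chow_deg (d * size l) (\prod_(i <- l) F i).
Proof.
move=> degF; elim: l => [|i l [p hp eqp]].
  by rewrite big_nil muln0; exists 1; rewrite ?dhomog1 // rmorph1.
have [q hq eqq] := degF i; rewrite big_cons mulnS; exists (q * p).
  exact: dhomogM.
by rewrite rmorphM /= -eqp -eqq.
Qed.

Lemma chow_deg_divisor f : chow_deg 1 (divisor G f).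
Proof.
exists (\sum_(S : psub G) (f (val S))%:MP * chow_var S).
  by apply: rpred_sum => S _; rewrite mul_mpolyC dhomogZ // dhomogX /= mdeg1.
by rewrite rmorph_sum; apply: eq_bigr => S _; rewrite rmorphM.
Qed.

Variable g : T.
Hypothesis Gg : g \in G.

Definition higgs_divisor i :=
  divisor G (fun A => (g \in A)%:R - (dropped (higgs N i.+1) (higgs N i) A)%:R).

(** Descends from the Boolean matroid, where every set is a flat and the class is 1. The list is
    reversed so that the divisor of the current step comes last, as in [bergman_step]. *)
Lemma bergman_higgs n k : (k + n)%N = nullity N ->
  bergman_on_flags (higgs N k) (\prod_(i <- rev (iota k n)) higgs_divisor i).
Proof.
elim: n k => [|n IHn] k.
  rewrite addn0 => -> s fs; rewrite /mrank rk_higgs_nullity // => szs.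
  rewrite big_nil mul1r chow_integral_flag //; case: allP => // -[] S sS.
  apply/flatP; split; first exact: psub_sub.
  move=> x Gx nSx; rewrite !rk_higgs_nullity ?psub_sub //; last first.
    by rewrite subUset sub1set Gx psub_sub.
  by rewrite cardsU1 nSx.
move=> eq_n; rewrite /= rev_cons -cats1 big_cat big_seq1 /=.
apply: bergman_step => //.
- exact: higgs_rk_le.
- exact: higgs_rk_diff_mono.
- by apply: higgs_rk_top; rewrite -eq_n; clear; lia.
- exact: loopless_higgs.
by apply: IHn; rewrite addSnnS.
Qed.

Lemma bergman_class_exists : exists z, is_bergman_class N z.
Proof.
exists (\prod_(i <- rev (iota 0 (nullity N))) higgs_divisor i); split.
  rewrite -[(_ - _)%N]mul1n -/(nullity N) -{1}(size_iota 0 (nullity N)) -size_rev.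
  by apply: chow_deg_prod => i; apply: chow_deg_divisor.
move=> s /chain_flag fs szs.
rewrite (bergman_higgs (add0n _)) //; last by rewrite szs /mrank rk_higgs0.
have -> : all (fun S => flat (higgs N 0) (val S)) s = all (fun S => flat N (val S)) s.
  apply: eq_all => S; apply: flat_eq_rk => A; rewrite inE; exact: rk_higgs0.
by case: all.
Qed.

End BergmanExists.

(** Covers both branches of [bergman_class]; later arguments see the class only through these
    integrals. *)
Lemma bergman_class_flags (T : finType) (G : {set T}) (N : matroid G) s :
  G != set0 -> flag s -> size s = (mrank N).-1 ->
  integral (bergman_class N * \prod_(S <- s) x_ S) =
  (loopless N && all (fun S : psub G => flat N (val S)) s)%:R.
Proof.
move=> G0; have [g Gg] := set0Pn _ G0; rewrite /bergman_class.
case: ifPn => [lN|_ _ _]; last by rewrite mul0r chow_integral0.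
move=> /flag_chain[s' ps cs] szs.
have [_ hz] : is_bergman_class N (classical_sets.xget 0 (is_bergman_class N)).
  by have [z zP] := bergman_class_exists G0 lN Gg; apply: classical_sets.xgetI zP.
rewrite (perm_big _ ps) /= hz -?(perm_size ps) // (perm_all _ ps).
by case: all.
Qed.

(** * The star of a flat *)

Section Minors.
Variables (T : finType) (E : {set T}) (M : matroid E) (F : {set T}).
Hypothesis sF : F \subset E.
Local Open Scope nat_scope.
Implicit Types A : {set T}.

Lemma rk_restr A : A \subset F -> rk (restr M F) A = rk M A.
Proof. by move=> sA; rewrite /= /restr_rk (setIidPl (subset_trans sA sF)). Qed.

Lemma rk_contr A : A \subset E -> rk (contr M F) A = rk M (A :|: F) - rk M F.
Proof.
by move=> sA; rewrite /= /contr_rk (setIidPl sF) (setIidPl _) // subUset sA.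
Qed.

Lemma mrank_restr : mrank (restr M F) = rk M F.
Proof. exact: rk_restr. Qed.

Lemma mrank_contr : mrank (contr M F) = crk M F.
Proof.
by rewrite /mrank rk_contr ?subsetDl // setUC -{1}(setIidPr sF) setID.
Qed.

Hypothesis fF : flat M F.

Lemma flat_restr A : A \subset F -> flat (restr M F) A = flat M A.
Proof.
move=> sAF; have sA := subset_trans sAF sF.
apply/flatP/flatP => -[_ hA]; split=> // x Gx nAx; last first.
  have sxA : x |: A \subset F by rewrite subUset sub1set Gx.
  by rewrite !rk_restr //; apply: hA; rewrite // (subsetP sF).
have [Fx|nFx] := boolP (x \in F).
  have sxA : x |: A \subset F by rewrite subUset sub1set Fx.
  by have := hA x Fx nAx; rewrite !rk_restr.
(* An element outside [F] raises the rank of [F], hence by submodularity that of its subset [A]. *)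
have /flatP[_ hF] := fF; have := hF x Gx nFx.
have sxA : x |: A \subset E by rewrite subUset sub1set Gx.
have := rk_submod M sxA sF; rewrite -setUA (setUidPr sAF).
have := rk_mono M (_ : A \subset (x |: A) :&: F) (subset_trans (subsetIr _ _) sF).
by rewrite subsetI subsetUr sAF => /(_ isT); clear; lia.
Qed.

Lemma flat_contr A : A \subset E :\: F -> flat (contr M F) A = flat M (A :|: F).
Proof.
move=> sA; have sAE := subset_trans sA (subsetDl _ _).
have sAF : A :|: F \subset E by rewrite subUset sAE.
have rF : rk M F <= rk M (A :|: F) by apply: rk_mono; rewrite ?subsetUr.
have rkx x : x \in E -> rk (contr M F) (x |: A) = rk M (x |: (A :|: F)) - rk M F.
  by move=> Ex; rewrite rk_contr ?setUA // subUset sub1set Ex.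
apply/flatP/flatP => -[_ hA]; split=> // x Ex.
  rewrite inE negb_or => /andP[nAx nFx]; have := hA x _ nAx.
  by rewrite inE nFx Ex rkx // rk_contr // => /(_ isT); move: rF; clear; lia.
move: Ex; rewrite inE => /andP[nFx Ex] nAx; have := hA x Ex.
by rewrite inE negb_or nAx nFx rkx // rk_contr // => /(_ isT); move: rF; clear; lia.
Qed.

Lemma loopless_contr : loopless (contr M F).
Proof. by rewrite loopless_flat0 flat_contr ?sub0set // set0U. Qed.

Lemma loopless_restr : loopless (restr M F) = loopless M.
Proof. by rewrite !loopless_flat0 flat_restr ?sub0set. Qed.

End Minors.

Section Star.
Variables (T : finType) (E : {set T}) (F : psub E).
Notation FC := (E :\: val F).
Implicit Types (S : psub E).

Lemma psubl_subproof (U : psub (val F)) : (val U != set0) && (val U \proper E).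
Proof. by rewrite psub_neq0 (sub_proper_trans (psub_sub U)) //; case/andP: (valP F). Qed.

Definition psubl (U : psub (val F)) : psub E := Sub (val U) (psubl_subproof U).

Lemma psubr_subproof (U : psub FC) :
  (val U :|: val F != set0) && (val U :|: val F \proper E).
Proof.
rewrite setU_eq0 (negbTE (psub_neq0 U)) /= properE subUset psub_sub andbT.
rewrite (subset_trans (psub_sub U)) ?subsetDl //=.
have /andP[_ /properP[_ [x]]] := valP U; rewrite inE => /andP[nFx Ex] nUx.
by apply/subsetPn; exists x; rewrite // inE negb_or nUx.
Qed.

(** Together with [psubl], this identifies the rays adjacent to that of [F] with those of the
    permutohedral fans of [val F] and of its complement. *)
Definition psubr (U : psub FC) : psub E := Sub (val U :|: val F) (psubr_subproof U).

Lemma psubl_inj : injective psubl.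
Proof. by move=> U V /(congr1 val) /= /val_inj. Qed.

Lemma psubr_setD (U : psub FC) : val (psubr U) :\: val F = val U.
Proof.
rewrite /= setDUl setDv setU0; apply/setDidPl.
by rewrite disjoint_sym disjoints_subset; apply/subsetP => x Fx; rewrite inE;
   apply: contraL Fx => /(subsetP (psub_sub U)); rewrite inE => /andP[].
Qed.

Lemma psubr_inj : injective psubr.
Proof.
move=> U V eUV; apply: val_inj; rewrite -psubr_setD -[RHS]psubr_setD.
by rewrite eUV.
Qed.

Lemma sum_injective (I J : finType) (V : nmodType) (h : I -> J) (P : pred J) (c : J -> V) :
  injective h -> (forall j, P j = (j \in codom h)) ->
  \sum_(j | P j) c j = \sum_i c (h i).
Proof.
move=> inj_h hP; have -> : \sum_(j | P j) c j = \sum_(j in h @: [set: I]) c j.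
  apply: eq_bigl => j; rewrite hP; apply/codomP/imsetP => [[i ->]|[i _ ->]].
    by exists i; rewrite ?inE.
  by exists i.
rewrite big_imset /=; last exact: in2W.
by apply: eq_bigl => i; rewrite inE.
Qed.

Lemma mem_psubl S : (val S \proper val F) = (S \in codom psubl).
Proof.
apply/idP/codomP => [pSF|[U ->]]; last by case/andP: (valP U).
have pS : (val S != set0) && (val S \proper val F) by rewrite psub_neq0.
by exists (exist (fun A : {set T} => (A != set0) && (A \proper val F)) _ pS); apply: val_inj.
Qed.

Lemma mem_psubr S : (val F \proper val S) = (S \in codom psubr).
Proof.
apply/idP/codomP => [pFS|[U ->]]; last first.
  rewrite properE subsetUr /=; have /set0Pn[x Ux] := psub_neq0 U.
  apply/subsetPn; exists x; first by rewrite inE Ux.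
  by have := subsetP (psub_sub U) x Ux; rewrite inE => /andP[].
have [sFS [x Sx nFx]] := properP pFS; have /andP[_ /properP[sSE [y Ey nSy]]] := valP S.
have pS : (val S :\: val F != set0) && (val S :\: val F \proper FC).
  apply/andP; split; first by apply/set0Pn; exists x; rewrite inE nFx.
  apply/properP; split; first exact: setSD.
  by exists y; rewrite inE ?Ey ?(negbTE nSy) ?andbF ?andbT // (contra _ nSy) //; apply: subsetP.
exists (exist (fun A : {set T} => (A != set0) && (A \proper FC)) _ pS); apply: val_inj.
by rewrite /= setUC -{1}(setIidPr sFS) setID.
Qed.

(** Sets incomparable with [F] die against [x_ F], and [f (val F) = 0] removes the square of
    [x_ F]. *)
Lemma x_divisor_split (f : {set T} -> rat) : f (val F) = 0 ->
  x_ F * divisor E f =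
  x_ F * (\sum_(U : psub (val F)) chow_scalar E (f (val U)) * x_ (psubl U) +
          \sum_(U : psub FC) chow_scalar E (f (val U :|: val F)) * x_ (psubr U)).
Proof.
move=> fF0; pose c S := chow_scalar E (f (val S)) * x_ S.
rewrite -(sum_injective c psubl_inj mem_psubl) -(sum_injective c psubr_inj mem_psubr).
rewrite /divisor (bigID (fun S : psub E => val S \proper val F)) /= mulrDr [RHS]mulrDr.
congr (_ + _).
rewrite (bigID (fun S : psub E => val F \proper val S)) /= mulrDr [X in _ + X]mulr_sumr.
rewrite [X in _ + X]big1 ?addr0.
  congr (_ * _); apply: eq_bigl => S; apply: andb_idl => /proper_sub sFS.
  by rewrite properE sFS andbF.
move=> S /andP[npSF npFS]; have [->|neSF] := eqVneq S F.
  by rewrite fF0 rmorph0 mul0r mulr0.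
rewrite mulrCA x_incomparable ?mulr0 //; apply/andP; split.
  by apply: contra npFS => sFS; rewrite properEneq sFS andbT eq_sym (inj_eq val_inj).
by apply: contra npSF => sSF; rewrite properEneq sSF andbT (inj_eq val_inj).
Qed.

Lemma divisor_lrel a b :
  divisor E (fun A => (a \in A)%:R - (b \in A)%:R) = lrel (@x_ T E) a b.
Proof.
by rewrite lrelE; apply: eq_bigr => S _; rewrite rmorphB !rmorph_nat.
Qed.

(** The same relation in [E]: sets above [F] contain both elements and drop out. In [lrel_psubr] the
    sets below [F] contain neither. *)
Lemma lrel_psubl a b : a \in val F -> b \in val F ->
  x_ F * lrel (fun U : psub (val F) => x_ (psubl U)) a b = 0.
Proof.
move=> Fa Fb; have sF := psub_sub F.
have := x_lrel (subsetP sF _ Fa) (subsetP sF _ Fb); rewrite -divisor_lrel.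
move/(congr1 ( *%R (x_ F))); rewrite mulr0 x_divisor_split ?Fa ?Fb ?subrr //.
rewrite [X in _ + X]big1 ?addr0 => [<-|U _].
  rewrite lrelE; congr (_ * _); apply: eq_bigr => U _.
  by rewrite rmorphB !rmorph_nat.
by rewrite !inE Fa Fb !orbT subrr rmorph0 mul0r.
Qed.

Lemma lrel_psubr a b : a \in FC -> b \in FC ->
  x_ F * lrel (fun U : psub FC => x_ (psubr U)) a b = 0.
Proof.
rewrite !inE => /andP[nFa Ea] /andP[nFb Eb].
have := x_lrel Ea Eb; rewrite -divisor_lrel.
move/(congr1 ( *%R (x_ F))).
rewrite mulr0 x_divisor_split ?(negbTE nFa) ?(negbTE nFb) ?subrr //.
rewrite [X in X + _]big1 ?add0r => [<-|U _].
  rewrite lrelE; congr (_ * _); apply: eq_bigr => U _.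
  by rewrite !inE (negbTE nFa) (negbTE nFb) !orbF rmorphB !rmorph_nat.
rewrite !(contraNF (subsetP (psub_sub U) _)) //.
by rewrite subrr rmorph0 mul0r.
Qed.

Lemma incomparable_psubl U V : incomparable U V -> incomparable (psubl U) (psubl V).
Proof. by []. Qed.

Lemma incomparable_psubr U V : incomparable U V -> incomparable (psubr U) (psubr V).
Proof.
have sub U' V' : (val (psubr U') \subset val (psubr V')) -> val U' \subset val V'.
  by move/(setSD (val F)); rewrite !psubr_setD.
by case/andP=> nUV nVU; apply/andP; split; [apply: contra nUV|apply: contra nVU]; apply: sub.
Qed.

Lemma flag_star (s1 : seq (psub (val F))) (s2 : seq (psub FC)) :
  flag s1 -> flag s2 -> flag (map psubl s1 ++ F :: map psubr s2).
Proof.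
case/andP=> us1 /all_nestedP cs1 /andP[us2 /all_nestedP cs2].
have pl U : val (psubl U) \proper val F by rewrite mem_psubl codom_f.
have pr U : val F \proper val (psubr U) by rewrite mem_psubr codom_f.
apply/andP; split.
  rewrite cat_uniq /= !map_inj_uniq ?us1 ?us2 ?andbT //=; [|exact: psubr_inj|exact: psubl_inj].
  apply/andP; split; last first.
    by apply/mapP => -[U _ eF]; have := pr U; rewrite -eF properxx.
  apply/norP; split.
    by apply/mapP => -[U _ eF]; have := pl U; rewrite -eF properxx.
  apply/hasPn => S /mapP[U _ ->]; apply/mapP => -[V _ eUV].
  have pUF : val (psubr U) \proper val F by rewrite eUV.
  by have := proper_trans (pr U) pUF; rewrite properxx.
apply/all_nestedP => S1 S2; rewrite !mem_cat !inE.
case/or3P=> [/mapP[U sU ->]|/eqP->|/mapP[U sU ->]];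
case/or3P=> [/mapP[V sV ->]|/eqP->|/mapP[V sV ->]].
- exact: (cs1 U V sU sV).
- by rewrite nestedE proper_sub.
- by rewrite nestedE proper_sub // (proper_trans (pl U) (pr V)).
- by rewrite nestedE orbC proper_sub.
- exact: nestedxx.
- by rewrite nestedE proper_sub.
- by rewrite nestedE orbC proper_sub // (proper_trans (pl V) (pr U)).
- by rewrite nestedE orbC proper_sub.
have := cs2 U V sU sV; rewrite !nestedE /=.
by case/orP=> sub; apply/orP; [left|right]; apply: setSU.
Qed.

End Star.

Section Comparison.
Variables (T : finType) (G : {set T}) (R : comNzRingType).
Variables (X : psub G -> R) (k : {rmorphism rat -> R}) (phi : R -> rat).
Hypothesis G_neq0 : G != set0.
Hypothesis phiD : forall r r', phi (r + r') = phi r + phi r'.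
Hypothesis phiZ : forall c r, phi (k c * r) = c * phi r.
Hypothesis phi_inc : forall S U r, incomparable S U -> phi (X S * X U * r) = 0.
Hypothesis phi_lrel : forall a b r, a \in G -> b \in G -> phi (lrel X a b * r) = 0.
Variables (w : chow G) (c : rat) (d : nat).
Hypothesis phi_flag : forall s, flag s -> size s = d ->
  phi (\prod_(S <- s) X S) = c * integral (w * \prod_(S <- s) x_ S).

(* Straightening in the product ring [R * chow G] compares both sides at once,
   which avoids the quotient of [R] through which [phi] factors. *)
Lemma comparison (l : seq (psub G -> rat)) : size l = d ->
  phi (\prod_(f <- l) \sum_(S : psub G) k (f S) * X S) =
  c * integral (w * \prod_(f <- l) \sum_(S : psub G) chow_scalar G (f S) * x_ S).
Proof.
move=> szl; pose RR := (R * chow G)%type; pose XX S : RR := (X S, x_ S).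
pose kk e : RR := (k e, chow_scalar G e).
pose P (r : RR) := phi r.1 = c * integral (w * r.2).
have phi0 : phi 0 = 0 by have := phiD 0 0; rewrite addr0; lra.
have P0 : P 0 by rewrite /P /= phi0 mulr0 chow_integral0 // mulr0.
have PD r r' : P r -> P r' -> P (r + r').
  by rewrite /P /= phiD mulrDr chow_integralD // mulrDr => -> ->.
have PZ e r : P r -> P (kk e * r).
  by rewrite /P /= phiZ mulrCA chow_integralZ // mulrCA => ->.
have fstE (I : Type) (r : seq I) (g : I -> RR) :
  (\prod_(i <- r) g i).1 = \prod_(i <- r) (g i).1 by exact: rmorph_prod.
have sndE (I : Type) (r : seq I) (g : I -> RR) :
  (\prod_(i <- r) g i).2 = \prod_(i <- r) (g i).2 by exact: rmorph_prod.
have fstS (p : pred (psub G)) (g : psub G -> RR) :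
  (\sum_(i | p i) g i).1 = \sum_(i | p i) (g i).1 by exact: raddf_sum.
have sndS (p : pred (psub G)) (g : psub G -> RR) :
  (\sum_(i | p i) g i).2 = \sum_(i | p i) (g i).2 by exact: raddf_sum.
have lrel1 a b : (lrel XX a b).1 = lrel X a b.
  transitivity ((\sum_(S : psub G | a \in val S) XX S).1 -
    (\sum_(S : psub G | b \in val S) XX S).1) => //.
  by rewrite !fstS.
have lrel2 a b : (lrel XX a b).2 = lrel (@x_ T G) a b.
  transitivity ((\sum_(S : psub G | a \in val S) XX S).2 -
    (\sum_(S : psub G | b \in val S) XX S).2) => //.
  by rewrite !sndS.
suff: P (\prod_(f <- l) \sum_(S : psub G) kk (f S) * XX S).
  rewrite /P fstE sndE; under eq_bigr do rewrite fstS.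
  by under [in RHS]eq_bigr do rewrite sndS.
apply: (prod_linear_forms P0 PD PZ _ szl) => s szs.
apply: (@straighten _ _ _ XX P d) => //.
- move=> r r' Pr Pr'; apply: PD => //.
  have kkN1 : kk (-1) = -1 by rewrite /kk !rmorphN1.
  by rewrite -mulN1r -kkN1; apply: PZ.
- move=> S U s' iSU _; rewrite /P /= phi_inc // x_incomparable // mul0r mulr0.
  by rewrite chow_integral0 // mulr0.
- move=> a b s' Ga Gb _; have PM (r r' : RR) :
    P (r * r') = (phi (r.1 * r'.1) = c * integral (w * (r.2 * r'.2))).
    by [].
  rewrite PM lrel1 lrel2 phi_lrel // x_lrel //.
  by rewrite mul0r mulr0 chow_integral0 // mulr0.
by move=> s' fs' szs'; rewrite /P fstE sndE phi_flag.
Qed.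

End Comparison.

(** * The Bergman class on the star of a flat *)

Section Product.
Variables (T : finType) (E : {set T}) (M : matroid E) (F : psub E).
Notation FC := (E :\: val F).
Notation MF := (restr M (val F)).
Notation MC := (contr M (val F)).

Definition form (G : {set T}) (f : psub G -> rat) : chow G :=
  \sum_(S : psub G) chow_scalar G (f S) * x_ S.

Definition forml (f : psub (val F) -> rat) : chow E :=
  \sum_(U : psub (val F)) chow_scalar E (f U) * x_ (psubl U).

Definition formr (f : psub FC -> rat) : chow E :=
  \sum_(U : psub FC) chow_scalar E (f U) * x_ (psubr U).

Let sF : val F \subset E := psub_sub F.

Let E_neq0 : E != set0.
Proof.
by apply: contraTneq (psub_card_lt F) => E0; rewrite [#|E|](_ : _ = 0%N) // E0 cards0.
Qed.

Let FC_neq0 : FC != set0.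
Proof. by have [x Ex nFx] := psub_compl F; apply/set0Pn; exists x; rewrite inE nFx. Qed.

(** The rank condition is a dimension count: [d1] is the number of factors on the side of [F]. *)
Definition star_matroid d1 := flat M (val F) && (rk M (val F) == d1.+1).

Lemma bergman_star_flags (s1 : seq (psub (val F))) (s2 : seq (psub FC)) :
  flag s1 -> flag s2 -> (size s1 + size s2).+2 = mrank M ->
  integral (bergman_class M * (x_ F * (\prod_(U <- s1) x_ (psubl U)) *
     \prod_(U <- s2) x_ (psubr U))) =
  (star_matroid (size s1))%:R * integral (bergman_class MF * \prod_(U <- s1) x_ U) *
    integral (bergman_class MC * \prod_(U <- s2) x_ U).
Proof.
move=> fs1 fs2 szM; pose s := map (@psubl _ _ F) s1 ++ F :: map (@psubr _ _ F) s2.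
have -> : x_ F * (\prod_(U <- s1) x_ (psubl U)) * \prod_(U <- s2) x_ (psubr U) =
    \prod_(S <- s) x_ S.
  by rewrite big_cat big_cons !big_map /= mulrCA mulrA.
rewrite bergman_class_flags //; last 2 first.
- exact: flag_star.
- by rewrite -szM size_cat /= !size_map addnS.
rewrite all_cat /= !all_map /star_matroid.
have [fF|_] := boolP (flat M (val F)); last by rewrite /= !andbF !mul0r.
have -> : all (preim (@psubl _ _ F) (fun S => flat M (val S))) s1 =
    all (fun U => flat MF (val U)) s1.
  by apply: eq_all => U; rewrite /= flat_restr // psub_sub.
have -> : all (preim (@psubr _ _ F) (fun S => flat M (val S))) s2 =
    all (fun U => flat MC (val U)) s2.
  by apply: eq_all => U; rewrite /= flat_contr // psub_sub.
have lMF := loopless_restr sF fF; have lMC := loopless_contr sF fF.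
have rF : (rk M (val F) < mrank M)%N.
  by apply: flat_rk_lt => //; rewrite properEneq psub_neqG.
(* The lengths of [s1] and [s2] add up to [(rk F - 1) + (crk F - 1)]; if the first is wrong, one of
   the flags is too long to consist of flats of its minor. *)
case: eqP => [rkF|nrkF] /=; last first.
  rewrite !mul0r; case: (boolP (_ && _)) => // /and3P[lM fl1 fl2].
  case: nrkF; rewrite -lMF in lM.
  have := flag_flats_size lM fs1 fl1; have := flag_flats_size lMC fs2 fl2.
  rewrite mrank_restr // mrank_contr // /crk.
  have := loopless_rk_gt0 (_ : loopless M) (psub_neq0 F) sF; rewrite -lMF => /(_ lM).
  by move: szM rF; clear; simpl; lia.
rewrite mul1r !bergman_class_flags ?psub_neq0 //; last 2 first.
- by rewrite mrank_contr // /crk -szM rkF subSS subSn ?leq_addr // addKn.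
- by rewrite mrank_restr // rkF.
rewrite lMF lMC /=; case: (loopless M); rewrite ?mul0r //=.
by case: (all _ s1); rewrite ?mul0r ?mul1r.
Qed.

(** [comparison] is applied once per side: first over the complement with the factors on [F] held
    fixed, then over [F] against a fixed flag of the complement. *)
Lemma bergman_star (l1 : seq (psub (val F) -> rat)) (l2 : seq (psub FC -> rat)) :
  (size l1 + size l2).+2 = mrank M ->
  integral (bergman_class M * (x_ F * (\prod_(f <- l1) forml f) * \prod_(f <- l2) formr f)) =
  (star_matroid (size l1))%:R * integral (bergman_class MF * \prod_(f <- l1) form f) *
    integral (bergman_class MC * \prod_(f <- l2) form f).
Proof.
move=> szM; pose y1 := \prod_(f <- l1) forml f.
pose phi2 (r : chow E) := integral (bergman_class M * (x_ F * y1 * r)).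
apply: (@comparison _ FC _ (fun U => x_ (psubr U)) (chow_scalar E) phi2 FC_neq0 _ _ _ _
  (bergman_class MC) _ (size l2)); rewrite /phi2 //.
- by move=> r r'; rewrite -chow_integralD // -!mulrDr.
- by move=> c r; rewrite -chow_integralZ //; congr integral; ring.
- move=> S U r /incomparable_psubr iSU.
  by rewrite x_incomparable // mul0r !mulr0 chow_integral0.
- move=> a b r Fa Fb; rewrite [_ * y1 * _]mulrACA lrel_psubr //.
  by rewrite mul0r mulr0 chow_integral0.
move=> s2 fs2 sz2; pose y2 := \prod_(U <- s2) x_ (psubr U).
pose phi1 (r : chow E) := integral (bergman_class M * (x_ F * r * y2)).
rewrite [RHS]mulrAC -/y2.
apply: (@comparison _ (val F) _ (fun U => x_ (psubl U)) (chow_scalar E) phi1 (psub_neq0 F) _ _ _ _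
  (bergman_class MF) _ (size l1)); rewrite /phi1 //.
- by move=> r r'; rewrite -chow_integralD // -mulrDr -mulrDl -mulrDr.
- by move=> c r; rewrite -chow_integralZ //; congr integral; ring.
- move=> S U r /incomparable_psubl iSU.
  by rewrite x_incomparable // !(mul0r, mulr0) chow_integral0.
- move=> a b r Fa Fb.
  by rewrite [_ * (lrel _ _ _ * _)]mulrA lrel_psubl // !(mul0r, mulr0) chow_integral0.
move=> s1 fs1 sz1; rewrite bergman_star_flags //; last by rewrite sz1 sz2.
by rewrite sz1 [RHS]mulrAC.
Qed.

End Product.

(** * The classes L_i *)

Section LClasses.
Variables (T : finType) (E : {set T}).
Implicit Types (A F : {set T}) (S : psub E).

(** The difference is the combination, with coefficients [u a], of the linear relations of [a] and
    [g]. *)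
Lemma divisor_eq (f f' : {set T} -> rat) (g : T) (u : T -> rat) : g \in E ->
  (forall S, f (val S) - f' (val S) =
     \sum_(a in E) u a * (a \in val S)%:R - (\sum_(a in E) u a) * (g \in val S)%:R) ->
  divisor E f = divisor E f'.
Proof.
move=> Eg eq_ff'; apply/eqP; rewrite -subr_eq0 -sumrB; apply/eqP.
transitivity (\sum_(a in E) chow_scalar E (u a) * lrel (@x_ T E) a g); last first.
  by rewrite big1 // => a Ea; rewrite x_lrel // mulr0.
have lE a : chow_scalar E (u a) * lrel (@x_ T E) a g =
    \sum_(S : psub E) chow_scalar E (u a * ((a \in val S)%:R - (g \in val S)%:R)) * x_ S.
  rewrite lrelE mulr_sumr; apply: eq_bigr => S _.
  by rewrite !rmorphM rmorphB !rmorph_nat mulrA.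
rewrite (eq_bigr _ (fun a _ => lE a)) exchange_big /=; apply: eq_bigr => S _.
rewrite -mulrBl -rmorphB -mulr_suml -rmorph_sum eq_ff'; congr (chow_scalar E _ * _).
by rewrite mulr_suml -sumrB; apply: eq_bigr => a _; rewrite mulrBr.
Qed.

Lemma sum_delta (g : T) (c : T -> rat) : g \in E ->
  \sum_(a in E) (a == g)%:R * c a = c g.
Proof.
move=> Eg; rewrite (bigD1 g) //= eqxx mul1r big1 ?addr0 // => a /andP[_ /negbTE->].
by rewrite mul0r.
Qed.

Lemma sum_mem A F : A \subset E ->
  \sum_(a in E) (a \in A)%:R * (a \in F)%:R = #|A :&: F|%:R :> rat.
Proof.
move=> sA; rewrite -sumr_const [RHS]big_mkcond [LHS]big_mkcond /=.
apply: eq_bigr => a _; rewrite inE; have [Aa|] := boolP (a \in A).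
  by rewrite (subsetP sA) // mul1r; case: (_ \in F).
by rewrite mul0r if_same.
Qed.

Definition Lcoef (g : T) (i : nat) A : rat :=
  (minn (#|E| - i) #|A|)%:R - (if g \in A then (#|E| - i)%N%:R else 0).

Lemma L_divisor g i : L E g i = divisor E (Lcoef g i).
Proof. by []. Qed.

End LClasses.

Section StarL.
Variables (T : finType) (E : {set T}) (F : psub E).
Notation FC := (E :\: val F).
Variables (g0 gl gr : T).
Hypotheses (Eg0 : g0 \in E) (Fgl : gl \in val F) (FCgr : gr \in FC).

Let sF : val F \subset E := psub_sub F.

Lemma card_FC : (#|E| = #|FC| + #|val F|)%N.
Proof. by rewrite cardsDS // subnK // subset_leq_card. Qed.

(* Subtracting the linear function [A |-> #|val F :&: A|], based at [gr], makes
   the coefficient of [F] and of all its subsets vanish. *)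
Lemma x_L_right i : (i <= #|FC|)%N ->
  x_ F * L E g0 i = x_ F * formr (fun U : psub FC => Lcoef FC gr i (val U)).
Proof.
move=> le_i; pose f' (A : {set T}) : rat := (minn (#|E| - i) #|A|)%:R -
  #|val F :&: A|%:R - (#|FC| - i)%:R * (gr \in A)%:R.
have [nFgr Egr] : gr \notin val F /\ gr \in E by move: FCgr; rewrite inE => /andP[].
have cE := card_FC.
(* Weight 1 on each element of [F] and [#|FC| - i] at [gr]: the total [#|E| - i] cancels the term of
   [L] at [g0]. *)
rewrite L_divisor (@divisor_eq _ _ _ f' g0
  (fun a => (a \in val F)%:R + (a == gr)%:R * (#|FC| - i)%:R)) //; last first.
  move=> S; under eq_bigr do rewrite mulrDl.
  rewrite big_split sum_mem //=
    (eq_bigr (fun a => (a == gr)%:R * ((#|FC| - i)%:R * (a \in val S)%:R))); last first.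
    by move=> a _; rewrite mulrA.
  rewrite sum_delta // big_split /= sum_delta // /f' /Lcoef.
  have -> : \sum_(a in E) (a \in val F)%:R = #|val F|%:R :> rat.
    rewrite -[in RHS](setIT (val F)) -(sum_mem _ sF); apply: eq_bigr => a _.
    by rewrite inE mulr1.
  rewrite -natrD; have -> : (#|val F| + (#|FC| - i) = #|E| - i)%N.
    by move: cE le_i; clear; lia.
  case: (g0 \in val S); rewrite ?mulr1 ?mulr0; ring.
have f'F : f' (val F) = 0.
  rewrite /f' setIid (negbTE nFgr) mulr0 subr0 (minn_idPr _) ?subrr //.
  by move: cE le_i; clear; lia.
rewrite (x_divisor_split f'F); congr (_ * _).
rewrite [X in X + _]big1 ?add0r => [|U _]; last first.
  have sUF := psub_sub U; rewrite /f' (contraNF (subsetP sUF gr) nFgr) mulr0 subr0.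
  rewrite (setIidPr sUF) (minn_idPr _) ?subrr ?rmorph0 ?mul0r //.
  by move: cE le_i (subset_leq_card sUF); clear; lia.
apply: eq_bigr => U _; congr (chow_scalar E _ * _).
have dUF : [disjoint val U & val F].
  rewrite disjoints_subset; apply/subsetP => x /(subsetP (psub_sub U)).
  by rewrite !inE => /andP[].
have cU : #|val U :|: val F| = (#|val U| + #|val F|)%N.
  by rewrite cardsU (disjoint_setI0 dUF) cards0 subn0.
rewrite /f' /Lcoef (setIidPl (subsetUr _ _)) inE (negbTE nFgr) orbF cU.
have -> : minn (#|E| - i) (#|val U| + #|val F|) = (minn (#|FC| - i) #|val U| + #|val F|)%N.
  by move: cE le_i; clear; lia.
by rewrite natrD addrK; case: (gr \in val U); rewrite ?mulr1 ?mulr0.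
Qed.

(** The origin of the condition in [Zset] that the exponent of index [n + 1 - #|F|] be 0. *)
Lemma formr_top : formr (fun U : psub FC => Lcoef FC gr #|FC| (val U)) = 0.
Proof.
rewrite /formr big1 // => U _; rewrite /Lcoef subnn min0n if_same subrr.
by rewrite rmorph0 mul0r.
Qed.

(** Rebased at [gl] in [F], the class has coefficient 0 on every set containing [F], whose size is
    at least [#|val F| - i]; subsets of [F] keep their coefficient since [#|E| - (i + #|FC|)] is
    [#|val F| - i]. *)
Lemma x_L_left i : (i < #|val F|)%N ->
  x_ F * L E g0 (i + #|FC|) = x_ F * forml (fun U : psub (val F) => Lcoef (val F) gl i (val U)).
Proof.
move=> lt_i; pose f' := Lcoef E gl (i + #|FC|).
have cE := card_FC; have cEi : (#|E| - (i + #|FC|) = #|val F| - i)%N.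
  by rewrite cE; clear; lia.
have Egl : gl \in E := subsetP sF _ Fgl.
rewrite L_divisor (@divisor_eq _ _ _ f' g0
  (fun a => (a == gl)%:R * (#|val F| - i)%:R)) //; last first.
  move=> S; rewrite (eq_bigr (fun a =>
    (a == gl)%:R * ((#|val F| - i)%:R * (a \in val S)%:R))); last first.
    by move=> a _; rewrite mulrA.
  rewrite !sum_delta // /f' /Lcoef cEi.
  by do 2 case: ifP => _; rewrite ?mulr1 ?mulr0; ring.
have min_F k : (#|val F| <= k)%N -> minn (#|val F| - i) k = (#|val F| - i)%N.
  by move=> le_k; apply/minn_idPl; apply: leq_trans (leq_subr _ _) le_k.
have f'F : f' (val F) = 0 by rewrite /f' /Lcoef cEi Fgl min_F // subrr.
rewrite (x_divisor_split f'F); congr (_ * _).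
rewrite [X in _ + X]big1 ?addr0 => [|U _]; last first.
  rewrite /f' /Lcoef inE Fgl orbT cEi min_F ?subrr ?rmorph0 ?mul0r //.
  exact/subset_leq_card/subsetUr.
by apply: eq_bigr => U _; congr (chow_scalar E _ * _); rewrite /f' /Lcoef cEi.
Qed.

End StarL.

Lemma prod_flatten_nseq (I J : Type) (R : comNzRingType) (r : seq I) (a : I -> nat)
    (c : I -> J) (G : J -> R) :
  \prod_(i <- r) G (c i) ^+ a i =
  \prod_(f <- flatten [seq nseq (a i) (c i) | i <- r]) G f.
Proof.
have E k j : \prod_(f <- nseq k j) G f = G j ^+ k.
  by elim: k => [|k IHk]; rewrite ?big_nil //= big_cons IHk exprS.
by elim: r => [|i r IHr]; rewrite ?big_nil //= big_cons big_cat /= E IHr.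
Qed.

Lemma size_flatten_nseq (I J : Type) (r : seq I) (a : I -> nat) (c : I -> J) :
  size (flatten [seq nseq (a i) (c i) | i <- r]) = (\sum_(i <- r) a i)%N.
Proof.
by elim: r => [|i r IHr]; rewrite ?big_nil //= big_cons size_cat size_nseq IHr.
Qed.

(** Factors are replaced one at a time, each against the same [x], brought next to them by
    commutativity. *)
Lemma mul_prod_congr (R : comNzRingType) (I : eqType) (r : seq I) (a : I -> nat)
    (x : R) (u v : I -> R) :
  {in r, forall i, x * u i = x * v i} ->
  x * \prod_(i <- r) u i ^+ a i = x * \prod_(i <- r) v i ^+ a i.
Proof.
have powE i k : x * u i = x * v i -> x * u i ^+ k = x * v i ^+ k.
  move=> e; elim: k => // k IHk.
  by rewrite !exprS mulrA e mulrAC IHk mulrAC -mulrA.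
elim: r => [|i r IHr] uv; first by rewrite !big_nil.
rewrite !big_cons mulrA powE ?uv ?mem_head // mulrAC IHr; last first.
  by move=> k rk; apply: uv; rewrite inE rk orbT.
by rewrite mulrAC -mulrA.
Qed.

Lemma big_star (T : finType) (E : {set T}) (F : psub E) (R : Type) (idx : R)
    (op : Monoid.law idx) (c : nat -> R) (FC := E :\: val F) :
  \big[op/idx]_(1 <= i < #|E|) c i =
  op (\big[op/idx]_(1 <= i < #|FC|) c i)
     (op (c #|FC|) (\big[op/idx]_(1 <= i < #|val F|) c (i + #|FC|)%N)).
Proof.
have cE := card_FC F; have F_gt0 := psub_card_gt0 F.
have FC_gt0 : (0 < #|FC|)%N.
  by move: (psub_card_lt F); rewrite cE -[ltnLHS]add0n ltn_add2r.
have ltFCE : (#|FC| < #|E|)%N by rewrite cE -[ltnLHS]addn0 ltn_add2l.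
rewrite (big_cat_nat FC_gt0 (ltnW ltFCE)) /= [X in op _ X]big_ltn //.
by rewrite -[#|FC|.+1]add1n big_addn cE addKn.
Qed.

Section Star.
Variables (T : finType) (E : {set T}) (M : matroid E) (F : psub E).
Notation FC := (E :\: val F).
Notation MF := (restr M (val F)).
Notation MC := (contr M (val F)).
Variables (g0 gl gr : T) (a : nat -> nat).
Hypotheses (Eg0 : g0 \in E) (Fgl : gl \in val F) (FCgr : gr \in FC).
Hypothesis sum_a : ((\sum_(1 <= i < #|E|) a i) + 2 = mrank M)%N.
Notation d1 := (\sum_(1 <= i < #|val F|) a (i + #|FC|)%N)%N.

Lemma bergman_star_L :
  integral (bergman_class M * (x_ F * \prod_(1 <= i < #|E|) L E g0 i ^+ a i)) =
  ((a #|FC| == 0%N) && star_matroid M F d1)%:R *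
  integral (bergman_class MF * \prod_(1 <= i < #|val F|) L (val F) gl i ^+ a (i + #|FC|)%N) *
  integral (bergman_class MC * \prod_(1 <= i < #|FC|) L FC gr i ^+ a i).
Proof.
have E_neq0 : E != set0 by apply/set0Pn; exists g0.
have sz := sum_a; rewrite (big_star F) /= in sz.
rewrite (big_star F) /=.
have right : {in index_iota 1 #|FC|, forall i, x_ F * L E g0 i =
    x_ F * formr (fun U : psub FC => Lcoef FC gr i (val U))}.
  by move=> i; rewrite mem_index_iota => /andP[_ lt_i]; apply: x_L_right => //; apply: ltnW.
have left : {in index_iota 1 #|val F|, forall i, x_ F * L E g0 (i + #|FC|) =
    x_ F * forml (fun U : psub (val F) => Lcoef (val F) gl i (val U))}.
  by move=> i; rewrite mem_index_iota => /andP[_ lt_i]; apply: x_L_left.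
have [a0|an0] := eqVneq (a #|FC|) 0%N; last first.
  have x0 : x_ F * L E g0 #|FC| ^+ a #|FC| = 0.
    rewrite -(prednK (n := a #|FC|)) ?lt0n // exprS mulrA.
    by rewrite (x_L_right Eg0 FCgr (leqnn _)) formr_top mulr0 mul0r.
  set P1 := \prod_(1 <= i < #|FC|) _; set P2 := \prod_(1 <= i < _) _.
  set Q := L _ _ _ ^+ _ in x0 *.
  have -> : x_ F * (P1 * (Q * P2)) = x_ F * Q * (P1 * P2) by ring.
  by rewrite x0 mul0r mulr0 chow_integral0 // !mul0r.
rewrite a0 expr0 mul1r.
rewrite [X in integral (_ * X)](_ : _ = x_ F *
    (\prod_(1 <= i < #|val F|)
       forml (fun U : psub (val F) => Lcoef (val F) gl i (val U)) ^+ a (i + #|FC|)%N) *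
    (\prod_(1 <= i < #|FC|)
       formr (fun U : psub FC => Lcoef FC gr i (val U)) ^+ a i)); last first.
  by rewrite mulrA (mul_prod_congr _ right) mulrAC (mul_prod_congr _ left).
rewrite (prod_flatten_nseq _ _ _ (@formr _ _ F)) (prod_flatten_nseq _ _ _ (@forml _ _ F)).
rewrite bergman_star; last first.
  by rewrite !size_flatten_nseq -sz a0 add0n addn2 addnC.
by rewrite size_flatten_nseq -!prod_flatten_nseq.
Qed.

End Star.

(** * Averaging over the base point and the recursion *)

Lemma L_average (n j : nat) (g : 'I_n.+1) : (1 <= j <= n)%N ->
  L [set: 'I_n.+1] g j =
  divisor [set: 'I_n.+1] (fun A => Bcoef n j (n.+1 - #|A|)%N).
Proof.
move=> /andP[j_gt0 le_jn]; rewrite L_divisor.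
have cT : #|[set: 'I_n.+1]| = n.+1 by rewrite cardsT card_ord.
(* Equal weights of total [n.+1 - j] spread the term at [g] evenly over the ground set. *)
apply: (@divisor_eq _ _ _ _ g (fun=> (n.+1 - j)%:R / n.+1%:R)); rewrite ?inE // => S.
rewrite -mulr_sumr sumr_const cT.
have -> : \sum_(a in [set: 'I_n.+1]) (a \in val S)%:R = #|val S|%:R :> rat.
  rewrite -[in RHS](setTI (val S)) -(sum_mem _ (subxx _)); apply: eq_bigr => a _.
  by rewrite inE mul1r.
have n1 : n.+1%:R != 0 :> rat by rewrite pnatr_eq0.
have lt_S := psub_card_lt S; rewrite cT in lt_S.
rewrite /Lcoef /Bcoef cT -[_ / _ *+ n.+1]mulr_natr divfK //.
have -> : minn j (n.+1 - #|val S|) = (n.+1 - maxn (n.+1 - j) #|val S|)%N.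
  by move: lt_S j_gt0 le_jn; clear; simpl; lia.
have -> : maxn j (n.+1 - #|val S|) = (n.+1 - minn (n.+1 - j) #|val S|)%N.
  by move: lt_S j_gt0 le_jn; clear; simpl; lia.
have E1 : (n.+1 - j <= n.+1)%N by rewrite leq_subr.
move: (n.+1 - j)%N E1 => p le_p; move: #|val S| lt_S => s lt_s.
have -> : (if g \in val S then p%:R else 0) = p%:R * (g \in val S)%:R :> rat.
  by case: (g \in val S); rewrite ?mulr1 ?mulr0.
have [le_ps|lt_sp] := leqP p s.
  by rewrite !natrB ?(ltnW lt_s) //; field; rewrite nat1r pnatr_eq0.
by rewrite !natrB ?(ltnW lt_s) //; field; rewrite nat1r pnatr_eq0.
Qed.

Lemma mixed_eulerianE (T : finType) (G : {set T}) (N : matroid G) : G != set0 ->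
  exists2 g, g \in G & forall a,
    mixed_eulerian N a =
    integral (bergman_class N * \prod_(1 <= i < #|G|) L G g i ^+ a i).
Proof.
case/set0Pn=> x Gx; rewrite /mixed_eulerian.
by case: pickP => [g Gg|/(_ x)]; [exists g|rewrite Gx].
Qed.

Theorem theorem1p9 (n : nat) (M : matroid [set: 'I_n.+1]) (a : nat -> nat)
    (j : nat)
    (ha : ((\sum_(1 <= i < n.+1) a i) + 2 = mrank M)%N)
    (hj : (1 <= j <= n)%N) :
  mixed_eulerian M (fun i : nat => (a i + (i == j))%N) =
  \sum_(F in Zset M a)
    Bcoef n j (n.+1 - #|F|)%N
      * mixed_eulerian (contr M F) a
      * mixed_eulerian (restr M F) (fun i : nat => a (n.+1 - #|F| + i)%N).
Proof.
have cT : #|[set: 'I_n.+1]| = n.+1 by rewrite cardsT card_ord.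
have ha' : ((\sum_(1 <= i < #|[set: 'I_n.+1]|) a i) + 2 = mrank M)%N by rewrite cT.
have T_neq0 : [set: 'I_n.+1] != set0 by apply/set0Pn; exists ord0; rewrite inE.
have [g _ ->] := mixed_eulerianE M T_neq0.
have -> : \prod_(1 <= i < #|[set: 'I_n.+1]|) L [set: 'I_n.+1] g i ^+ (a i + (i == j)) =
    L [set: 'I_n.+1] g j * \prod_(1 <= i < #|[set: 'I_n.+1]|) L [set: 'I_n.+1] g i ^+ a i.
  under eq_bigr do rewrite exprD.
  rewrite big_split /= mulrC; congr (_ * _).
  rewrite (bigD1_seq j) ?iota_uniq ?mem_index_iota ?cT //= eqxx expr1.
  by rewrite big1 ?mulr1 // => i /negbTE->; rewrite expr0.
rewrite L_average // mulr_suml mulr_sumr chow_integral_sum //.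
(* The expanded divisor runs over all nonempty proper sets; those outside [Zset] will contribute
   0. *)
pose Zsub := [set S : psub [set: 'I_n.+1] | val S \in Zset M a].
have -> : Zset M a = val @: Zsub.
  apply/setP => F; apply/idP/imsetP => [ZF|[S]]; last by rewrite inE => ZS ->.
  have pF : (F != set0) && (F \proper [set: 'I_n.+1]).
    by move: ZF; rewrite inE properT => /and5P[_ -> ->].
  exists (exist (fun A : {set 'I_n.+1} => (A != set0) && (A \proper _)) F pF) => //.
  by rewrite /Zsub in_set.
rewrite big_imset; last by apply: in2W; apply: val_inj.
rewrite [RHS]big_mkcond; apply: eq_bigr => S _; rewrite inE.
rewrite -[X in integral (_ * X)]mulrA [X in integral X]mulrCA chow_integralZ //.
have [gl Fgl El] := mixed_eulerianE (restr M (val S)) (psub_neq0 S).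
have FC_neq0 : [set: 'I_n.+1] :\: val S != set0.
  by have [x Ex nSx] := psub_compl S; apply/set0Pn; exists x; rewrite inE nSx.
have [gr FCgr Er] := mixed_eulerianE (contr M (val S)) FC_neq0.
rewrite El Er (bergman_star_L _ Fgl FCgr ha') ?in_setT //.
have lt_S := psub_card_lt S; rewrite cT in lt_S.
have cFC : #|[set: 'I_n.+1] :\: val S| = (n.+1 - #|val S|)%N.
  have := card_FC S; rewrite cT => eS; apply/eqP.
  by rewrite -(eqn_add2r #|val S|) -eS subnK // ltnW.
(* [Zset] counts dimensions on the side of the contraction, [star_matroid] on that of the
   restriction. The total of the exponents makes the two equivalent once the middle exponent is
   0. *)
have -> : (val S \in Zset M a) = (a #|[set: 'I_n.+1] :\: val S| == 0%N) &&
    star_matroid M S (\sum_(1 <= i < #|val S|) a (i + #|[set: 'I_n.+1] :\: val S|)%N).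
  rewrite inE (psub_neq0 S) (psub_neqG S) /= /star_matroid -cFC [RHS]andbCA.
  case: (flat M _) => //=; case: eqP => //= a0.
  rewrite -subSn // -cFC; have := ha'; rewrite (big_star S) /= a0.
  have := rk_mono M (psub_sub S) (subxx _); rewrite /crk -/(mrank M).
  by clear; simpl; lia.
case: ifP => _; last by rewrite !mul0r mulr0.
rewrite mul1r [RHS]mulrAC -mulrA -cFC; congr (_ * (_ * _)).
by congr (integral (_ * _)); apply: eq_bigr => i _; rewrite addnC.
Qed.
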